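(* Let $G$ be a transitive subgroup of the symmetric group $S_6$ which contains a subgroup isomorphic to $C_3 \times C_3$, and assume $G \neq A_6$ and $G \neq S_6$. Then for every field $K$ with $\operatorname{char}(K) \neq 2,3$, Noether's problem for $G$ over $K$ has a positive answer, i.e. $K(G)$ is rational over $K$. For $G = S_6$, the field $K(G)$ is rational over $K$ for every field $K$ with $\operatorname{char}(K)\neq 2,3,5$.
   Context: For a finite group $G$ and a field $K$, let $\{x_g\}_{g\in G}$ be a family of independent variables indexed by $G$, and let $G$ act on the rational function field $K(x_g : g\in G)$ by $K$-automorphisms with $h(x_g)=x_{hg}$ for all $h,g\in G$. Put $K(G)=K(x_g : g\in G)^G$, the fixed subfield. Noether's problem for $G$ over $K$ asks whether $K(G)$ is rational over $K$; a field extension of $K$ is called rational over $K$ if it is purely transcendental over $K$. $C_3$ is the cyclic group of order 3, and $A_6$ is the alternating subgroup of $S_6$. *)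

(* Defs.v *)
From HB Require Import structures.
From mathcomp Require Export all_boot all_order all_fingroup all_algebra.
From mathcomp Require Export all_solvable.
From mathcomp Require Export generic_quotient.
From mathcomp Require Export mpoly.

Set Implicit Arguments.
Unset Strict Implicit.
Unset Printing Implicit Defensive.

Import GRing.Theory.
Local Open Scope ring_scope.
Local Open Scope quotient_scope.

Local Notation "x %:F" := (@tofrac _ x).

Section PurelyTranscendental.

Variables (K L : fieldType) (iota : {rmorphism K -> L}).

Definition algebraically_independent (B : L -> Prop) : Prop :=
  forall (n : nat) (b : 'I_n -> L),
    injective b -> (forall i, B (b i)) ->
    forall p : {mpoly K[n]}, mmap iota b p = 0 -> p = 0.

(* K(B), the smallest subfield of L containing iota(K) and B.  Since          *)
(* 0^-1 = 0 in MathComp, closure under inversion needs no side condition.     *)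
Inductive adjoin (B : L -> Prop) : L -> Prop :=
| adjoin_base a : adjoin B (iota a)
| adjoin_gen x : B x -> adjoin B x
| adjoin_sub x y : adjoin B x -> adjoin B y -> adjoin B (x - y)
| adjoin_mul x y : adjoin B x -> adjoin B y -> adjoin B (x * y)
| adjoin_inv x : adjoin B x -> adjoin B x^-1.

(* The intermediate field F of the extension L of K is purely transcendental  *)
(* over K.                                                                    *)
Definition rational_over (F : {pred L}) : Prop :=
  exists B : L -> Prop,
    algebraically_independent B /\ (forall x, x \in F <-> adjoin B x).

End PurelyTranscendental.

Section NoetherProblem.

Variables (K : fieldType) (gT : finGroupType).

(* K[x_g : g in gT], with the variables numbered by enum_rank.                *)
Notation group_poly := {mpoly K[#|gT|]}.

(* K(x_g : g in gT)                                                           *)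
Notation group_frac := {fraction group_poly}.

Definition frac_const : K -> group_frac := @tofrac _ \o @mpolyC #|gT| K.
HB.instance Definition _ :=
  GRing.RMorphism.copy frac_const (@tofrac _ \o @mpolyC #|gT| K).

Definition poly_var (g : gT) : group_poly := 'X_(enum_rank g).

Definition frac_var (g : gT) : group_frac := (poly_var g)%:F.

Definition poly_act (h : gT) (p : group_poly) : group_poly :=
  p \mPo [tuple poly_var (h * enum_val i)%g | i < #|gT|].
HB.instance Definition _ h := GRing.RMorphism.copy (poly_act h)
  (comp_mpoly [tuple poly_var (h * enum_val i)%g | i < #|gT|]).

(* Computed on a chosen representative; frac_act_div shows that the choice    *)
(* is immaterial.                                                             *)
Definition frac_act (h : gT) (f : group_frac) : group_frac :=
  (poly_act h \n_(repr f))%:F / (poly_act h \d_(repr f))%:F.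

(* K(G)                                                                       *)
Definition noether_field : {pred group_frac} :=
  [pred f | [forall h : gT, frac_act h f == f]].

Definition noether_problem : Prop := rational_over frac_const noether_field.

Lemma poly_act_var h g : poly_act h (poly_var g) = poly_var (h * g)%g.
Proof.
by rewrite /poly_act /poly_var comp_mpolyXU -tnth_nth tnth_mktuple enum_rankK.
Qed.

Lemma poly_act_const h a : poly_act h a%:MP = a%:MP.
Proof. exact: comp_mpolyC. Qed.

Lemma poly_actM h k p : poly_act h (poly_act k p) = poly_act (h * k)%g p.
Proof.
rewrite [poly_act k p]comp_mpolyE [RHS]comp_mpolyE raddf_sum /=.
apply: eq_bigr => m _.
rewrite /poly_act comp_mpolyZ rmorph_prod /=; congr (_ *: _).
apply: eq_bigr => i _; rewrite rmorphXn /=; congr (_ ^+ _).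
by rewrite !tnth_mktuple -[LHS]/(poly_act h _) poly_act_var mulgA.
Qed.

Lemma poly_act1 p : poly_act 1%g p = p.
Proof.
rewrite -[RHS]comp_mpoly_id /poly_act; congr comp_mpoly.
by apply: eq_from_tnth => i; rewrite !tnth_mktuple mul1g /poly_var enum_valK.
Qed.

Lemma poly_act_eq0 h p : (poly_act h p == 0) = (p == 0).
Proof.
apply/eqP/eqP => [hp0 | ->]; last exact: rmorph0.
by rewrite -[p]poly_act1 -(mulVg h) -poly_actM hp0 rmorph0.
Qed.

Lemma frac_repr (f : group_frac) : f = (\n_(repr f))%:F / (\d_(repr f))%:F.
Proof.
set r := repr f; rewrite -[LHS]reprK -/r.
have d_neq0 : \d_r != 0 := denom_ratioP r.
rewrite -[in LHS](Ratio_numden r); unlock tofrac.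
rewrite -[X in _ = _ * X]FracField.pi_inv -[RHS]FracField.pi_mul.
rewrite /FracField.mulf /FracField.invf.
by rewrite !numden_Ratio ?oner_neq0 // mulr1 mul1r.
Qed.

Lemma frac_act_div h p q :
  q != 0 -> frac_act h (p%:F / q%:F) = (poly_act h p)%:F / (poly_act h q)%:F.
Proof.
set f := _ / _ => q_neq0.
have d_neq0 : \d_(repr f) != 0 := denom_ratioP (repr f).
have /eqP : f = (\n_(repr f))%:F / (\d_(repr f))%:F := frac_repr f.
rewrite {1}/f eqr_div ?tofrac_eq0 // -!tofracM tofrac_eq => /eqP pd_eq.
apply/eqP; rewrite eqr_div ?tofrac_eq0 ?poly_act_eq0 //.
by rewrite -!tofracM tofrac_eq -!rmorphM /= pd_eq mulrC.
Qed.

Lemma frac_act_poly h p : frac_act h p%:F = (poly_act h p)%:F.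
Proof.
by rewrite -[p%:F]divr1 -tofrac1 frac_act_div ?oner_neq0 // rmorph1 tofrac1 divr1.
Qed.

Lemma frac_act_var h g : frac_act h (frac_var g) = frac_var (h * g)%g.
Proof. by rewrite /frac_var frac_act_poly poly_act_var. Qed.

Lemma frac_act_const h a : frac_act h (frac_const a) = frac_const a.
Proof. by rewrite /frac_const /= frac_act_poly poly_act_const. Qed.

Lemma frac_act_is_zmod_morphism h : zmod_morphism (frac_act h).
Proof.
move=> x y; rewrite [x in LHS]frac_repr [y in LHS]frac_repr {2 3}/frac_act.
set p := \n_(repr x); set q := \d_(repr x).
set r := \n_(repr y); set s := \d_(repr y).
have q_neq0 : q != 0 := denom_ratioP _; have s_neq0 : s != 0 := denom_ratioP _.
rewrite -!mulNr -!tofracN !addf_div ?tofrac_eq0 ?poly_act_eq0 //.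
rewrite -!tofracM -!tofracD frac_act_div ?mulf_neq0 //.
by rewrite rmorphD !rmorphM rmorphN.
Qed.

Lemma frac_act_is_monoid_morphism h : monoid_morphism (frac_act h).
Proof.
split=> [|x y]; first by rewrite -tofrac1 frac_act_poly rmorph1.
rewrite [x in LHS]frac_repr [y in LHS]frac_repr {2 3}/frac_act.
have q_neq0 : \d_(repr x) != 0 := denom_ratioP _.
have s_neq0 : \d_(repr y) != 0 := denom_ratioP _.
rewrite !mulf_div -!tofracM frac_act_div ?mulf_neq0 //.
by rewrite !rmorphM.
Qed.

HB.instance Definition _ h := GRing.isZmodMorphism.Build group_frac group_frac
  (frac_act h) (frac_act_is_zmod_morphism h).
HB.instance Definition _ h := GRing.isMonoidMorphism.Build group_frac group_frac
  (frac_act h) (frac_act_is_monoid_morphism h).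

Lemma frac_actM h k f : frac_act h (frac_act k f) = frac_act (h * k)%g f.
Proof.
rewrite {2}/frac_act frac_act_div ?poly_act_eq0 ?denom_ratioP //.
by rewrite !poly_actM.
Qed.

Lemma frac_act1 f : frac_act 1%g f = f.
Proof. by rewrite /frac_act !poly_act1 -frac_repr. Qed.

Lemma noether_fieldP f :
  reflect (forall h, frac_act h f = f) (f \in noether_field).
Proof. exact: 'forall_eqP. Qed.

Lemma noether_field_const a : frac_const a \in noether_field.
Proof. by apply/noether_fieldP => h; apply: frac_act_const. Qed.

Lemma noether_field_divring_closed : divring_closed noether_field.
Proof.
split=> [|x y /noether_fieldP xP /noether_fieldP yP|
          x y /noether_fieldP xP /noether_fieldP yP];
  apply/noether_fieldP => h.
- exact: rmorph1.
- by rewrite rmorphB /= xP yP.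
- by rewrite fmorph_div /= xP yP.
Qed.

End NoetherProblem.

(* Main.v *)
From HB Require Import structures.
Require Import Defs.
From mathcomp Require Import fieldext ring.
From mathcomp Require boolp.

(** Write L for K(x_g : g in G). Both parts produce |G| invariants that generate
    L^G over K. This suffices: every x_g is a root of the product of the 'X - h x_g,
    hence algebraic over L^G, so |G| generators of L^G form a generating family
    of the right size for an extension of transcendence degree |G| and are
    algebraically independent ([noether_criterion], by Steinitz exchange).

    Let G act on the six points. The sums y_i of the x_g over the fibres of an
    orbit map G -> {points} are independent linear forms, and G permutes them
    as it permutes the points. If t is a monomial in the y_i with |G| distinct
    conjugates, the invariants b_k = sum_g g(t)^k x_g are related to the x_g by
    a Vandermonde matrix over K(y), so that |G| - 6 of them together with the
    y_i generate L ([no_name]). It remains to find six invariants c such that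
    every invariant lies in K(c, b).

    Invariants are pushed down a tower of simple extensions: if w is a root of
    a polynomial of degree d over F, and if d elements of G fix F pointwise and
    send w to d distinct elements, then every invariant of F(w) is in F, since
    it is q(w) with deg q < d and q takes the same value at d points
    ([adjoin_fixed_step]). For the symmetric group, c consists of the
    elementary symmetric functions of the y_i, and the tower adjoins the y_i
    one at a time ([noether_symmetric]).

    For the other groups, Sylow's theorem gives a labelling of the points such
    that the 3-cycles on two blocks of three points belong to G, and G permutes
    the two blocks, since these 3-cycles and a permutation that mixes the
    blocks generate a group containing the alternating group
    ([preserves_blocks]). On each block let e1 be the sum of the three y_i, D
    the product of their cyclic differences, P = e1^2 - 3 e2 and
    Q = 2 e1^3 - 9 e1 e2 + 27 e3. The 3-cycle has the fixed field
    K(e1, Q / P, D / P) ([cubic_step]), and any permutation of the block fixes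
    e1 and Q / P and multiplies D / P by a sign. So G acts on the six elements
    obtained from the two blocks by swapping the blocks and by signs on the two
    elements D / P; the image of G is one of four subgroups of the dihedral
    group of order 8, and each of them has a fixed field generated by six
    explicit elements ([signed_descent]). *)

Set Implicit Arguments.
Unset Strict Implicit.
Unset Printing Implicit Defensive.
Import GRing.Theory.
Local Open Scope ring_scope.

(** * Subfields generated by a set *)

Section Adjunction.

Variables (K L : fieldType) (iota : {rmorphism K -> L}).
Implicit Types (S T : L -> Prop) (s : seq L) (x y w : L) (p q : {poly L}).

Local Notation adj := (adjoin iota).
Local Notation adjs s := (adjoin iota (fun x => x \in s)).

Lemma adjoin0 S : adj S 0.
Proof. by rewrite -(rmorph0 iota); apply: adjoin_base. Qed.

Lemma adjoin1 S : adj S 1.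
Proof. by rewrite -(rmorph1 iota); apply: adjoin_base. Qed.

Lemma adjoin_trans S T :
  (forall x, S x -> adj T x) -> forall x, adj S x -> adj T x.
Proof.
move=> sST x; elim=> {x} [a | x /sST // | x y _ ? _ ? | x y _ ? _ ? | x _ ?].
- exact: adjoin_base.
- exact: adjoin_sub.
- exact: adjoin_mul.
- exact: adjoin_inv.
Qed.

Lemma adjoin_mono S T :
  (forall x, S x -> T x) -> forall x, adj S x -> adj T x.
Proof. by move=> sST; apply: adjoin_trans => x /sST; apply: adjoin_gen. Qed.

Lemma adjoin_fixed S (g : {rmorphism L -> L}) :
    (forall a, g (iota a) = iota a) -> (forall x, S x -> g x = x) ->
  forall x, adj S x -> g x = x.
Proof.
move=> g_iota gS x.
elim=> {x} [a | x /gS // | x y _ gx _ gy | x y _ gx _ gy | x _ gx] //.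
- by rewrite rmorphB /= gx gy.
- by rewrite rmorphM /= gx gy.
- by rewrite fmorphV /= gx.
Qed.

(** A boolean form of the inductive predicate [adjoin], so that the generated
    subfield can carry a field structure of its own. *)
Definition adjoinb S : {pred L} := fun x => boolp.asbool (adj S x).

Lemma adjoinbP S x : reflect (adj S x) (x \in adjoinb S).
Proof. exact: boolp.asboolP. Qed.

Fact adjoinb_divring_closed S : divring_closed (adjoinb S).
Proof.
split=> [|x y /adjoinbP Sx /adjoinbP Sy|x y /adjoinbP Sx /adjoinbP Sy];
  apply/adjoinbP.
- exact: adjoin1.
- exact: adjoin_sub.
- by apply: adjoin_mul => //; apply: adjoin_inv.
Qed.

HB.instance Definition _ S :=
  GRing.isDivringClosed.Build L (adjoinb S) (adjoinb_divring_closed S).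

Record subadjoin S := SubAdjoin { adjval : L; adjvalP : adjval \in adjoinb S }.

HB.instance Definition _ S := [isSub for @adjval S].
HB.instance Definition _ S := [Choice of subadjoin S by <:].
HB.instance Definition _ S :=
  [SubChoice_isSubIntegralDomain of subadjoin S by <:].
HB.instance Definition _ S := [SubIntegralDomain_isSubField of subadjoin S by <:].

Definition adjoin_val S : subadjoin S -> L := val.
HB.instance Definition _ S := GRing.RMorphism.copy (@adjoin_val S) (val : subadjoin S -> L).

Lemma adjoin_valP S (a : subadjoin S) : adj S (adjoin_val a).
Proof. by apply/adjoinbP; apply: adjvalP. Qed.

Lemma adjoin_valE S x : adj S x -> exists a : subadjoin S, x = adjoin_val a.
Proof. by move/adjoinbP=> Sx; exists (SubAdjoin Sx). Qed.

(** Polynomials over L are used instead of polynomials over [subadjoin S], so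
    that the base field can vary without casts. *)
Definition adj_poly S p := forall i, adj S p`_i.

Lemma adj_polyE S p : adj_poly S p ->
  exists q : {poly subadjoin S}, p = map_poly (@adjoin_val S) q.
Proof.
move=> Sp; have Sp' i : p`_i \in adjoinb S by apply/adjoinbP.
exists (\poly_(i < size p) (SubAdjoin (Sp' i))).
apply/polyP=> i; rewrite coef_map coef_poly.
by case: ltnP => // szp; rewrite /= rmorph0 nth_default.
Qed.

Lemma adj_poly_map S (q : {poly subadjoin S}) :
  adj_poly S (map_poly (@adjoin_val S) q).
Proof. by move=> i; rewrite coef_map; apply: adjoin_valP. Qed.

Lemma adj_poly_horner S p x : adj_poly S p -> adj S x -> adj S p.[x].
Proof.
move=> /adj_polyE[q ->] /adjoin_valE[a ->].
by rewrite horner_map; apply: adjoin_valP.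
Qed.

Lemma adj_poly_mono S T p :
  (forall x, adj S x -> adj T x) -> adj_poly S p -> adj_poly T p.
Proof. by move=> sST Sp i; apply: sST. Qed.

Lemma adj_polyB S p q : adj_poly S p -> adj_poly S q -> adj_poly S (p - q).
Proof. by move=> Sp Sq i; rewrite coefB; apply: adjoin_sub. Qed.

Lemma adj_polyM S p q : adj_poly S p -> adj_poly S q -> adj_poly S (p * q).
Proof.
by move=> /adj_polyE[a ->] /adj_polyE[b ->]; rewrite -rmorphM; apply: adj_poly_map.
Qed.

Lemma adj_polyC S x : adj S x -> adj_poly S x%:P.
Proof. by move=> Sx i; rewrite coefC; case: eqP => // _; apply: adjoin0. Qed.

Lemma adj_polyX S : adj_poly S 'X.
Proof. by move=> i; rewrite coefX; case: eqP => // _; [apply: adjoin1 | apply: adjoin0]. Qed.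

(** The values q(w) form a field: this is the quotient construction of a simple
    extension, mapped into L. Reduction modulo p bounds the degree of q. *)
Lemma adjoin_simple (s : seq L) w p d :
    p != 0 -> (size p <= d.+1)%N -> adj_poly (fun x => x \in s) p -> root p w ->
  forall x, adjs (w :: s) x ->
  exists q, [/\ adj_poly (fun x => x \in s) q, (size q <= d)%N & x = q.[w]].
Proof.
set S := fun x => x \in s.
move=> p_nz szp Sp pw0 x.
have [p1 Dp] := adj_polyE Sp.
have p1_nz : p1 != 0 by apply: contra_neq p_nz => p1z; rewrite Dp p1z rmorph0.
have p1w : root (map_poly (@adjoin_val S) p1) w by rewrite -Dp.
have szp1 : (size p1 <= d.+1)%N by rewrite Dp size_map_poly in szp.
pose inj := @subfx_inj _ _ (@adjoin_val S) w p1.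
suffices E : adjs (w :: s) x -> exists z, x = inj z.
  case/E=> z ->; have [q ->] := subfxE z; exists (map_poly (@adjoin_val S) (q %% p1)).
  split; first exact: adj_poly_map.
    by rewrite size_map_poly -ltnS (leq_trans _ szp1) // ltn_modp.
  rewrite /inj subfx_inj_eval // {1}(divp_eq q p1) rmorphD rmorphM /=.
  by rewrite hornerD hornerM (rootP p1w) mulr0 add0r.
have inj_val a : adj S a -> exists z, a = inj z.
  move=> /adjoin_valE[b ->]; exists (subfx_eval _ w p1 b%:P).
  by rewrite /inj subfx_inj_eval // map_polyC hornerC.
elim=> {x} [a | x | x y _ [u ->] _ [v ->] | x y _ [u ->] _ [v ->] | x _ [u ->]].
- by apply: inj_val; apply: adjoin_base.
- rewrite inE => /orP[/eqP-> | xs].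
    exists (subfx_root _ w p1); rewrite /inj subfx_inj_root //.
  by apply: inj_val; apply: adjoin_gen.
- by exists (u - v); rewrite /inj rmorphB.
- by exists (u * v); rewrite /inj rmorphM.
- by exists u^-1; rewrite /inj fmorphV.
Qed.

(** If x = q(w) with deg q < d, then q - x vanishes at the d distinct elements
    g i w, so q is constant and x is its constant coefficient. *)
Lemma adjoin_fixed_step (s : seq L) w p d (g : 'I_d -> {rmorphism L -> L}) x :
    p != 0 -> (size p <= d.+1)%N -> adj_poly (fun x => x \in s) p -> root p w ->
    (forall i a, g i (iota a) = iota a) ->
    (forall i y, y \in s -> g i y = y) ->
    injective (fun i => g i w) ->
    adjs (w :: s) x -> (forall i, g i x = x) -> adjs s x.
Proof.
move=> p_nz szp Sp pw0 g_iota gs gw_inj sx gx.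
have [q [Sq szq Dx]] := adjoin_simple p_nz szp Sp pw0 sx.
have gq i : q.[g i w] = x.
  rewrite -[RHS](gx i) Dx -horner_map; congr _.[_].
  apply/polyP=> j; rewrite coef_map /=.
  by rewrite (adjoin_fixed (g_iota i) (gs i) (Sq j)).
suffices/eqP : q - x%:P = 0.
  by rewrite subr_eq0 => /eqP Dq; have := Sq 0%N; rewrite Dq coefC.
apply: (@roots_geq_poly_eq0 _ _ [seq g i w | i <- enum 'I_d]).
- apply/allP=> _ /mapP[i _ ->].
  by rewrite rootE hornerD hornerN hornerC gq subrr.
- by rewrite map_inj_uniq ?enum_uniq.
rewrite size_map size_enum_ord (leq_trans (size_polyD _ _)) // size_polyN.
rewrite geq_max szq (leq_trans (size_polyC_leq1 _)) //.
by rewrite -ltnS (leq_trans (root_size_gt1 p_nz pw0)).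
Qed.

End Adjunction.

(** * Algebraic dependence and Steinitz exchange *)

Section AlgebraicClosure.

Variables (K L : fieldType) (iota : {rmorphism K -> L}).
Implicit Types (S T R : L -> Prop) (s t : seq L) (x y z : L) (p q : {poly L}).

Local Notation adj := (adjoin iota).
Local Notation adj_poly := (adj_poly iota).

Definition algebraic_over S x :=
  exists p, [/\ p != 0, adj_poly S p & root p x].

Local Notation alg := algebraic_over.
Local Notation mem_of s := (fun x => x \in s).

Lemma algebraic_overE S x :
  alg S x <-> integralOver (@adjoin_val _ _ iota S) x.
Proof.
rewrite -integral_algebraic; split=> [[p [p_nz /adj_polyE[q Dp] px]] | [q q_nz qx]].
  exists q; last by rewrite -Dp.
  by apply: contra_neq p_nz => q0; rewrite Dp q0 rmorph0.
exists (map_poly (@adjoin_val _ _ iota S) q); split=> //; last exact: adj_poly_map.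
by rewrite map_poly_eq0.
Qed.

Lemma algebraic_adjoin S x : adj S x -> alg S x.
Proof.
by move=> /adjoin_valE[a ->]; apply/algebraic_overE; apply: integral_id.
Qed.

Lemma algebraic_mono S T x :
  (forall y, S y -> T y) -> alg S x -> alg T x.
Proof.
move=> sST [p [p_nz Sp px]]; exists p; split=> //.
by apply: adj_poly_mono Sp; apply: adjoin_mono.
Qed.

Lemma algebraic_trans S T x : (forall y, T y -> alg S y) -> alg T x -> alg S x.
Proof.
move=> algT [p [p_nz Tp px]]; apply/algebraic_overE.
have adjT y : adj T y -> integralOver (@adjoin_val _ _ iota S) y.
  elim=> {y} [a | y /algT/algebraic_overE // | y z _ ? _ ? | y z _ ? _ ? | y _ ?].
  - by apply/algebraic_overE/algebraic_adjoin/adjoin_base.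
  - exact: integral_sub.
  - exact: integral_mul.
  - exact: integral_inv.
apply: (integral_root p_nz px) => y /(nthP 0)[i _ <-].
exact: adjT.
Qed.

Lemma adjoin_fraction S R :
    (forall a, R (iota a)) -> (forall x, S x -> R x) ->
    (forall x y, R x -> R y -> R (x - y)) ->
    (forall x y, R x -> R y -> R (x * y)) ->
  forall x, adj S x -> exists u v, [/\ R u, R v, v != 0 & x = u / v].
Proof.
move=> R_iota RS RB RM.
have R0 : R 0 by rewrite -(rmorph0 iota).
have R1 : R 1 by rewrite -(rmorph1 iota).
move=> x; elim=> {x} [a | x Sx | x y _ [u [v [Ru Rv v0 ->]]] _ [u' [v' [Ru' Rv' v'0 ->]]]
  | x y _ [u [v [Ru Rv v0 ->]]] _ [u' [v' [Ru' Rv' v'0 ->]]] | x _ [u [v [Ru Rv v0 ->]]]].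
- by exists (iota a), 1; split; rewrite ?oner_neq0 ?divr1.
- by exists x, 1; split; rewrite ?oner_neq0 ?divr1 //; apply: RS.
- exists (u * v' - u' * v), (v * v'); split; rewrite ?mulf_neq0 //.
  + by apply: RB; apply: RM.
  + exact: RM.
  + by rewrite -mulNr addf_div // mulNr.
- exists (u * u'), (v * v'); split; rewrite ?mulf_neq0 ?mulf_div //; exact: RM.
have [-> | u0] := eqVneq u 0.
  by exists 0, 1; split; rewrite ?oner_neq0 // !mul0r invr0.
by exists v, u; split=> //; rewrite invf_div.
Qed.

(** For R a subring containing S, the field generated by S consists of fractions
    of R; this multiplies the coefficients of p into R. *)
Lemma clear_denominators S R p :
    (forall a, R (iota a)) -> (forall x, S x -> R x) ->
    (forall x y, R x -> R y -> R (x - y)) ->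
    (forall x y, R x -> R y -> R (x * y)) ->
  adj_poly S p -> exists v, v != 0 /\ forall i, R (v * p`_i).
Proof.
move=> R_iota RS RB RM Sp.
have R0 : R 0 by rewrite -(rmorph0 iota).
have R1 : R 1 by rewrite -(rmorph1 iota).
have : exists v, [/\ R v, v != 0 & forall i, (i < size p)%N -> R (v * p`_i)].
  elim: (size p) => [|n [v [Rv v0 vp]]]; first by exists 1; rewrite oner_neq0.
  have [u [v' [Ru Rv' v'0 Dpn]]] := adjoin_fraction R_iota RS RB RM (Sp n).
  exists (v * v'); split; rewrite ?mulf_neq0 //; first exact: RM.
  move=> i; rewrite ltnS leq_eqVlt => /orP[/eqP-> | /vp Rvi].
    by rewrite Dpn mulrAC -mulrA divfK //; apply: RM.
  by rewrite mulrAC; apply: RM.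
case=> v [_ v0 vp]; exists v; split=> // i.
have [/vp // | szp] := ltnP i (size p).
by rewrite nth_default // mulr0.
Qed.

(** After clearing denominators, a relation of y over K(s, x) is a polynomial in
    two variables over K(s), to be read as a polynomial N in x over K(s, y). If N
    were zero, each of its coefficients would be a relation of y over K(s). *)
Lemma algebraic_exchange s x y :
  alg (mem_of (x :: s)) y -> ~ alg (mem_of s) y -> alg (mem_of (y :: s)) x.
Proof.
move=> [p [p_nz Sp py]] not_alg_y.
pose R z := exists q, adj_poly (mem_of s) q /\ z = q.[x].
have RC z : adj (mem_of s) z -> R z.
  by move=> sz; exists z%:P; split; [apply: adj_polyC | rewrite hornerC].
have RB u v : R u -> R v -> R (u - v).
  move=> [q [Sq ->]] [r [Sr ->]]; exists (q - r); rewrite hornerD hornerN.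
  by split=> //; apply: adj_polyB.
have RM u v : R u -> R v -> R (u * v).
  move=> [q [Sq ->]] [r [Sr ->]]; exists (q * r); rewrite hornerM.
  by split=> //; apply: adj_polyM.
have [||v [v0 Rvp]] := clear_denominators (R := R) _ _ RB RM Sp.
- by move=> a; apply/RC/adjoin_base.
- move=> z; rewrite inE => /orP[/eqP-> | sz]; last exact/RC/adjoin_gen.
  by exists 'X; rewrite hornerX; split=> //; apply: adj_polyX.
have [Q DQ] := boolp.choice Rvp.
pose N := \sum_(i < size p) Q i * (y ^+ i)%:P.
have yS : adj (mem_of (y :: s)) y by apply: adjoin_gen; rewrite inE eqxx.
have sub_s z : adj (mem_of s) z -> adj (mem_of (y :: s)) z.
  by apply: adjoin_mono => t st; rewrite inE st orbT.
have coefN k : N`_k = \sum_(i < size p) (Q i)`_k * y ^+ i.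
  by rewrite coef_sum; apply: eq_bigr => i _; rewrite coefMC.
exists N; split.
- apply/eqP=> N0; case: not_alg_y.
  have [i [k Qik]] : exists i k, (i < size p)%N /\ (Q i)`_k != 0.
    exists (size p).-1.
    have /boolp.existsNP[k /eqP Qk] : ~ forall k, (Q (size p).-1)`_k = 0.
      move=> Q0; have Q00 : Q (size p).-1 = 0 by apply/polyP=> k; rewrite Q0 coef0.
      have [_] := DQ (size p).-1; rewrite Q00 horner0 => /eqP.
      by rewrite mulf_eq0 (negPf v0) -/(lead_coef p) lead_coef_eq0 (negPf p_nz).
    by exists k; rewrite Qk prednK ?size_poly_gt0.
  case: Qik => lti Qik.
  exists (\poly_(i < size p) (Q i)`_k); split.
  + apply/eqP=> /polyP/(_ i); rewrite coef_poly lti coef0 => Q0.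
    by rewrite Q0 eqxx in Qik.
  + move=> j; rewrite coef_poly; case: ifP => _; last exact: adjoin0.
    by case: (DQ j) => + _; apply.
  + by rewrite rootE horner_poly -coefN N0 coef0.
- move=> k; rewrite coefN.
  suff : adj_poly (mem_of (y :: s)) (\poly_(i < size p) (Q i)`_k).
    by move/adj_poly_horner/(_ yS); rewrite horner_poly.
  move=> j; rewrite coef_poly; case: ifP => _; last exact: adjoin0.
  by case: (DQ j) => Sj _; apply: sub_s.
rewrite rootE horner_sum; apply/eqP.
transitivity (v * p.[y]); last by rewrite (rootP py) mulr0.
rewrite horner_coef mulr_sumr; apply: eq_bigr => i _.
by rewrite hornerM hornerC mulrA; case: (DQ i) => _ <-.
Qed.

(** The elements of xs replace those of s one at a time, and the family keeps
    spanning. The hypothesis on xs says that no entry depends on the earlier ones. *)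
Lemma steinitz (xs s : seq L) :
    (forall x, alg (mem_of s) x) ->
    (forall k, (k < size xs)%N -> ~ alg (mem_of (take k xs)) xs`_k) ->
  (size xs <= size s)%N.
Proof.
move=> spans indep.
suff E : forall k, (k <= size xs)%N -> exists s',
    size s = (k + size s')%N /\ forall z, alg (mem_of (take k xs ++ s')) z.
  by have [s' [-> _]] := E _ (leqnn _); rewrite leq_addr.
elim=> [|k IHk] ltk; first by exists s; rewrite take0.
have [s1 [szs1 spans1]] := IHk (ltnW ltk).
set x := xs`_k; set t := take k xs in spans1.
have takeS : take k.+1 xs = rcons t x by rewrite (take_nth 0).
(* The first element of s1 that makes x dependent is the one to be removed. *)
have [j [altj ltj]] : exists j, alg (mem_of (t ++ take j.+1 s1)) x /\
    ~ alg (mem_of (t ++ take j s1)) x /\ (j < size s1)%N.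
  have Ppos : ~ alg (mem_of (t ++ take 0 s1)) x.
    by rewrite take0 cats0; apply: indep.
  have Pend : alg (mem_of (t ++ take (size s1) s1)) x by rewrite take_size.
  elim: (size s1) Pend => [|m IHm] Pend //.
  have [/IHm[j [? [? ?]]] | nalg] := boolp.pselect (alg (mem_of (t ++ take m s1)) x).
    by exists j; split=> //; split=> //; apply: ltnW.
  by exists m.
case: ltj => nalg ltj; set u := s1`_j.
exists (take j s1 ++ drop j.+1 s1); split.
  rewrite szs1 size_cat size_takel ?size_drop 1?ltnW // addSnnS; congr addn.
  by rewrite subnS -addnS prednK ?subn_gt0 // subnKC // ltnW.
have eq1 z : (z \in t ++ take j.+1 s1) = (z \in u :: t ++ take j s1).
  by rewrite (take_nth 0) // !(mem_cat, inE, mem_rcons) orbCA.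
have alg_u : alg (mem_of (x :: t ++ take j s1)) u.
  apply: algebraic_exchange => //.
  by apply: algebraic_mono altj => z; rewrite eq1.
move=> z; apply: algebraic_trans (spans1 z) => y /=.
have -> : (y \in t ++ s1) = [|| y == u, y \in t, y \in take j s1 | y \in drop j.+1 s1].
  have E1 : (y \in s1) = [|| y == u, y \in take j s1 | y \in drop j.+1 s1].
    by rewrite -{1}(cat_take_drop j s1) (drop_nth 0) // mem_cat inE orbCA.
  by rewrite mem_cat E1 orbCA.
set t' := _ ++ _.
have sub w : w \in x :: t ++ take j s1 -> w \in t'.
  rewrite /t' takeS !(mem_cat, mem_rcons, inE) => /or3P[]->; by rewrite ?orbT.
have [-> _ | _ /= yt] := eqVneq y u; first by apply: algebraic_mono alg_u.
apply/algebraic_adjoin/adjoin_gen; rewrite /t' takeS.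
by move: yt; rewrite !(mem_cat, mem_rcons, inE) => /or3P[]-> //; rewrite ?orbT.
Qed.

End AlgebraicClosure.

Lemma mpoly_rmorph_eq n (R : comNzRingType) (A : nzRingType)
    (f g : {rmorphism {mpoly R[n]} -> A}) :
    (forall a, f a%:MP = g a%:MP) -> (forall i, f 'X_i = g 'X_i) -> f =1 g.
Proof.
move=> fgC fgX p; rewrite (mpolyE p) !rmorph_sum; apply: eq_bigr => m _.
rewrite -mul_mpolyC !rmorphM /= fgC mpolyXE_id !rmorph_prod /=; congr (_ * _).
by apply: eq_bigr => i _; rewrite !rmorphXn /= fgX.
Qed.

Section LastVariable.

Variables (n : nat) (R : comNzRingType).

(** The isomorphism of R[X_0, ..., X_n] with R[X_0, ..., X_(n-1)][X], given by the
    images of the variables. *)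
Definition last_univariate_var (i : 'I_n.+1) : {poly {mpoly R[n]}} :=
  if unlift ord_max i is Some j then ('X_j : {mpoly R[n]})%:P else 'X.

Definition last_univariate : {mpoly R[n.+1]} -> {poly {mpoly R[n]}} :=
  mmap (polyC \o @mpolyC n R) last_univariate_var.
HB.instance Definition _ := GRing.RMorphism.copy last_univariate
  (mmap (polyC \o @mpolyC n R) last_univariate_var).

Lemma last_univariateC a : last_univariate a%:MP = (a%:MP)%:P.
Proof. by rewrite /last_univariate mmapC. Qed.

Lemma last_univariateX i : last_univariate 'X_i = last_univariate_var i.
Proof. by rewrite /last_univariate mmapX mmap1U. Qed.

Lemma last_univariate_horner (A : comNzRingType) (f : {rmorphism R -> A})
    (b : 'I_n.+1 -> A) p :
  mmap f b p =
  (map_poly (mmap f (fun j : 'I_n => b (lift ord_max j))) (last_univariate p)).[b ord_max].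
Proof.
set ev := mmap f (fun j : 'I_n => b (lift ord_max j)).
pose g := horner_eval (b ord_max) \o map_poly ev \o last_univariate.
rewrite -[RHS]/(g p); apply: (mpoly_rmorph_eq (f := mmap f b) (g := g)) => [a|i].
  by rewrite /= mmapC /= last_univariateC map_polyC /horner_eval hornerC /= mmapC.
rewrite /= mmapX mmap1U /g /= last_univariateX /last_univariate_var /horner_eval.
case: unliftP => [j|] ->; last by rewrite map_polyX hornerX.
by rewrite map_polyC hornerC /= mmapX mmap1U.
Qed.

Lemma last_univariate_eq0 p : last_univariate p = 0 -> p = 0.
Proof.
move=> p0; have := last_univariate_horner (@mpolyC n.+1 R) (fun i => 'X_i) p.
rewrite p0 rmorph0 horner0 => <-.
apply: (mpoly_rmorph_eq (f := idfun) (g := mmap (@mpolyC n.+1 R) (fun i => 'X_i))).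
  by move=> a; rewrite /= mmapC.
by move=> i; rewrite /= mmapX mmap1U.
Qed.

End LastVariable.

Section Independence.

Variables (K L : fieldType) (iota : {rmorphism K -> L}).

Local Notation adj := (adjoin iota).
Local Notation alg := (algebraic_over iota).
Local Notation mem_of s := (fun x => x \in s).

Lemma adjoin_mmap n (b : 'I_n -> L) p :
  adj (fun x => exists i, x = b i) (mmap iota b p).
Proof.
apply/adjoinbP; rewrite /mmap; apply: rpred_sum => m _.
apply: rpredM; first exact/adjoinbP/adjoin_base.
by apply: rpred_prod => i _; apply: rpredX; apply/adjoinbP/adjoin_gen; exists i.
Qed.

(** Induction on the number of variables. Either the relation, read as a
    polynomial in the last variable, survives evaluation of the other variables,
    and the last element is algebraic over the previous ones; or one of its
    coefficients is a relation among fewer elements. *)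
Lemma dependent_algebraic n (b : 'I_n -> L) (p : {mpoly K[n]}) :
    p != 0 -> mmap iota b p = 0 ->
  exists k : 'I_n, alg (fun x => exists2 i : 'I_n, (i < k)%N & x = b i) (b k).
Proof.
elim: n => [|n IHn] in b p * => p_nz pb0.
  case/eqP: p_nz; apply/mpolyP=> m; rewrite mcoeff0.
  have m0 m' : m' = 0%MM :> 'X_{1..0} by apply/mnmP=> -[].
  have Dp : p = (p@_m)%:MP.
    by apply/mpolyP=> m'; rewrite mcoeffC (m0 m) (m0 m') eqxx mulr1.
  by move: pb0; rewrite Dp mmapC => /eqP; rewrite fmorph_eq0 => /eqP ->; rewrite mcoeff0.
pose b' (j : 'I_n) := b (lift ord_max j).
have := pb0; rewrite last_univariate_horner -/b'.
set q := map_poly _ _ => qb0.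
have [q0 | q_nz] := eqVneq q 0.
  have [i pi_nz] : exists i, (last_univariate p)`_i != 0.
    exists (size (last_univariate p)).-1; rewrite -[_`__]/(lead_coef _) lead_coef_eq0.
    by apply: contra_neq p_nz; apply: last_univariate_eq0.
  have [|k algk] := IHn b' _ pi_nz.
    by have /polyP/(_ i) := q0; rewrite coef_map coef0.
  exists (lift ord_max k); apply: algebraic_mono algk => _ [j ltj ->].
  by exists (lift ord_max j); rewrite ?lift_max.
exists ord_max, q; split=> //; last exact/rootP.
move=> i; rewrite coef_map; apply: adjoin_mono (adjoin_mmap _ _) => _ [j ->].
by exists (lift ord_max j); rewrite ?lift_max /=.
Qed.

(** An algebraic relation in s would make one element superfluous, and a smaller
    family would span. *)
Lemma spanning_independent (xs s : seq L) :
    (forall k, (k < size xs)%N -> ~ alg (mem_of (take k xs)) xs`_k) ->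
    (size s <= size xs)%N -> (forall x, alg (mem_of s) x) ->
  algebraically_independent iota (mem_of s).
Proof.
move=> indep szs spans n b b_inj bs p pb0; apply/eqP/negPn/negP=> p_nz.
have [k algk] := dependent_algebraic p_nz pb0.
pose s' := [seq x <- s | x != b k].
have spans' x : alg (mem_of s') x.
  apply: algebraic_trans (spans x) => y /= ys.
  have [-> | yk] := eqVneq y (b k); last first.
    by apply/algebraic_adjoin/adjoin_gen; rewrite mem_filter yk.
  apply: algebraic_mono algk => _ [i ltik ->]; rewrite mem_filter bs andbT.
  by apply: contraTneq ltik => /b_inj ->; rewrite ltnn.
have := steinitz spans' indep; apply/negP; rewrite -ltnNge (leq_trans _ szs) //.
rewrite size_filter -(count_predC (pred1 (b k)) s) -[X in (X < _)%N]add0n ltn_add2r.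
by rewrite -has_count has_pred1 bs.
Qed.

End Independence.

(** * From generators of the fixed field to rationality *)

Section FractionVariables.

Variables (K : fieldType) (gT : finGroupType).
Local Notation n := #|gT|.
Local Notation iota := (@frac_const K gT).
Local Notation mem_of s := (fun x => x \in s).

(** The polynomials in which X_k does not occur are the fixed points of the
    substitution kill of 0 for X_k. For such coefficients, a relation of X_k
    becomes a polynomial identity in one variable under the morphism psi. *)
Lemma var_transcendental (k : 'I_n) (s : seq {fraction {mpoly K[n]}}) :
    (forall x, x \in s -> exists2 i : 'I_n, i != k & x = tofrac 'X_i) ->
  ~ algebraic_over iota (mem_of s) (tofrac 'X_k).
Proof.
move=> s_var [p [p_nz Sp pX0]].
pose kill : {mpoly K[n]} -> {mpoly K[n]} :=
  mmap (@mpolyC n K) (fun i => if i == k then 0 else 'X_i).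
pose psi : {mpoly K[n]} -> {poly {mpoly K[n]}} :=
  mmap (polyC \o @mpolyC n K) (fun i => if i == k then 'X else ('X_i)%:P).
have psi_kill q : psi (kill q) = (kill q)%:P.
  apply: (mpoly_rmorph_eq
    (f := mmap (polyC \o @mpolyC n K) (fun i => if i == k then 'X else ('X_i)%:P)
       \o mmap (@mpolyC n K) (fun i => if i == k then 0 else 'X_i))
    (g := polyC \o mmap (@mpolyC n K) (fun i => if i == k then 0 else 'X_i))) => [a | i] /=.
    by rewrite !mmapC.
  rewrite !mmapX !mmap1U; case: (eqVneq i k) => ik; first by rewrite !rmorph0.
  by rewrite mmapX mmap1U (negPf ik).
pose R (x : {fraction {mpoly K[n]}}) := exists q, kill q = q /\ x = tofrac q.
have [||x y|x y|v [v0 Rvp]] := clear_denominators (R := R) _ _ _ _ Sp.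
- by move=> a; exists a%:MP; split=> //; rewrite /kill mmapC.
- move=> _ /s_var[i ik ->]; exists 'X_i; split=> //.
  by rewrite /kill mmapX mmap1U (negPf ik).
- move=> [q [kq ->]] [r [kr ->]]; exists (q - r); rewrite tofracB; split=> //.
  by rewrite /kill rmorphB /= -/(kill q) -/(kill r) kq kr.
- move=> [q [kq ->]] [r [kr ->]]; exists (q * r); rewrite tofracM; split=> //.
  by rewrite /kill rmorphM /= -/(kill q) -/(kill r) kq kr.
have [Q DQ] := boolp.choice Rvp.
have sum0 : \sum_(i < size p) Q i * 'X_k ^+ i = 0.
  apply/eqP; rewrite -tofrac_eq tofrac0 rmorph_sum /=; apply/eqP.
  transitivity (v * p.[tofrac 'X_k]); last by rewrite (rootP pX0) mulr0.
  rewrite horner_coef mulr_sumr; apply: eq_bigr => i _.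
  by rewrite tofracM tofracXn mulrA; case: (DQ i) => _ <-.
have psiQ i : psi (Q i) = (Q i)%:P by case: (DQ i) => <- _; rewrite psi_kill.
have /polyP/(_ (size p).-1) : \poly_(i < size p) Q i = 0.
  rewrite poly_def -[RHS](rmorph0 (mmap (polyC \o @mpolyC n K)
    (fun i => if i == k then 'X else ('X_i)%:P))) -sum0 rmorph_sum /=.
  apply: eq_bigr => i _; rewrite rmorphM rmorphXn /= -/(psi (Q i)) psiQ.
  by rewrite mmapX mmap1U eqxx mul_polyC.
rewrite coef_poly coef0 prednK ?size_poly_gt0 // leqnn => Q0.
have [_ /eqP] := DQ (size p).-1; rewrite Q0 tofrac0 mulf_eq0 (negPf v0) /=.
by rewrite -/(lead_coef p) lead_coef_eq0 (negPf p_nz).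
Qed.

(** Each polynomial f is a root of the product of the 'X - h f, whose coefficients
    are invariant; so L is algebraic over K(s), and s has at most as many elements as
    there are variables. *)
Lemma noether_criterion (s : seq {fraction {mpoly K[n]}}) :
    (size s <= n)%N ->
    (forall x, x \in s -> x \in @noether_field K gT) ->
    (forall x, x \in @noether_field K gT -> adjoin iota (mem_of s) x) ->
  noether_problem K gT.
Proof.
move=> szs s_inv gen_s; exists (mem_of s); split; last first.
  move=> x; split; first exact: gen_s.
  move=> sx; apply/noether_fieldP => h.
  apply: (adjoin_fixed (iota := iota)) sx => [a | y /s_inv/noether_fieldP]; last exact.
  exact: frac_act_const.
pose xs := [seq tofrac 'X_i : {fraction {mpoly K[n]}} | i <- enum 'I_n].
have szxs : size xs = n by rewrite size_map size_enum_ord.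
apply: (@spanning_independent _ _ _ xs); rewrite ?szxs //.
  move=> k ltk; pose i := Ordinal ltk.
  have -> : xs`_k = tofrac 'X_i.
    rewrite (nth_map i) ?size_enum_ord //; congr (tofrac 'X_ _).
    by apply: val_inj; rewrite /= nth_enum_ord.
  apply: var_transcendental => x; rewrite -map_take => /mapP[j jk ->]; exists j => //.
  apply: contraTneq jk => ->; rewrite -(mem_map val_inj) map_take val_enum_ord.
  by rewrite take_iota (minn_idPl (ltnW ltk)) mem_iota ltnn.
move=> x; apply: (@algebraic_trans _ _ _ _ (fun x => exists p, x = tofrac p)); last first.
  apply: algebraic_adjoin; rewrite (frac_repr x); apply: adjoin_mul.
    by apply: adjoin_gen; exists (\n_(repr x)).
  by apply/adjoin_inv/adjoin_gen; exists (\d_(repr x)).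
move=> _ [p ->]; set y := tofrac p.
exists (\prod_(h : gT) ('X - (frac_act h y)%:P)); split.
- by apply/prodf_neq0 => h _; rewrite polyXsubC_eq0.
- move=> i; apply: gen_s; apply/noether_fieldP => h.
  rewrite -[LHS](coef_map (frac_act h)) rmorph_prod /=; congr (polyseq _)`_i.
  rewrite [RHS](reindex_inj (mulgI h)) /=; apply: eq_bigr => g _.
  by rewrite rmorphB /= map_polyX map_polyC /= frac_actM.
by rewrite (bigD1 1%g) //= rootM frac_act1 root_XsubC eqxx.
Qed.

End FractionVariables.

(** * The reduction to six variables *)

Section NoName.

Variables (K : fieldType) (gT : finGroupType) (d : nat).
Variables (pt : gT -> 'I_d) (rho : gT -> 'S_d) (rep : 'I_d -> gT).
Hypothesis repK : cancel rep pt.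
Hypothesis ptM : forall h g, pt (h * g)%g = rho h (pt g).
Hypothesis rho_inj : injective rho.

Local Notation n := #|gT|.
Local Notation L := {fraction {mpoly K[n]}}.
Local Notation iota := (@frac_const K gT).
Local Notation adj := (adjoin iota).
Local Notation mem_of s := (fun x => x \in s).

Definition orbit_poly (i : 'I_d) : {mpoly K[n]} :=
  \sum_(g | pt g == i) poly_var K g.

Definition orbit_var (i : 'I_d) : L := tofrac (orbit_poly i).

Local Notation y := orbit_var.

Lemma frac_act_orbit_var h i : frac_act h (y i) = y (rho h i).
Proof.
rewrite /orbit_var frac_act_poly; congr tofrac; rewrite /orbit_poly raddf_sum.
rewrite [RHS](reindex_inj (mulgI h)) /=; apply: eq_big => g.
  by rewrite ptM (inj_eq perm_inj).
by rewrite poly_act_var.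
Qed.

Lemma mmap_orbit_var_eq0 (p : {mpoly K[d]}) : mmap iota y p = 0 -> p = 0.
Proof.
(* The y_i are sums over disjoint sets of variables: keeping one variable of
   each sum and killing the others is a left inverse of the substitution of the
   y_i. *)
pose sec : {mpoly K[n]} -> {mpoly K[d]} := mmap (@mpolyC d K)
  (fun k => let g := enum_val k in if g == rep (pt g) then 'X_(pt g) else 0).
pose sub : {mpoly K[d]} -> {mpoly K[n]} := mmap (@mpolyC n K) orbit_poly.
have Dsub q : mmap iota y q = tofrac (sub q).
  pose f := @tofrac _ \o mmap (@mpolyC n K) orbit_poly.
  apply: (mpoly_rmorph_eq (f := mmap iota y) (g := f)) => [a | i] /=.
    by rewrite !mmapC.
  by rewrite !mmapX !mmap1U.
have subK : cancel sub sec.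
  move=> q; pose f := mmap (@mpolyC d K)
    (fun k : 'I_n => let g := enum_val k in if g == rep (pt g) then 'X_(pt g) else 0)
      \o mmap (@mpolyC n K) orbit_poly.
  apply: (mpoly_rmorph_eq (f := f) (g := idfun)) => [a | i] /=; first by rewrite !mmapC.
  rewrite mmapX mmap1U rmorph_sum (bigD1 (rep i)) ?repK //=.
  rewrite /poly_var mmapX mmap1U /= enum_rankK repK eqxx big1 ?addr0 //.
  move=> g /andP[/eqP <- grep]; rewrite mmapX mmap1U /= enum_rankK.
  by rewrite (negPf grep).
rewrite Dsub => /eqP; rewrite tofrac_eq0 => /eqP sub0.
by rewrite -[p]subK sub0 /sec rmorph0.
Qed.

Lemma adjoin_frac_var S : (forall g, adj S (frac_var K g)) -> forall x : L, adj S x.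
Proof.
move=> SX x; have Sp p : adj S (tofrac p).
  rewrite (mpolyE p) rmorph_sum; apply/adjoinbP/rpred_sum => m _ /=.
  rewrite -mul_mpolyC tofracM mpolyXE_id rmorph_prod; apply: rpredM.
    by apply/adjoinbP/adjoin_base.
  apply: rpred_prod => i _ /=; rewrite tofracXn; apply/rpredX/adjoinbP.
  by rewrite -[i]enum_valK; apply: SX.
by rewrite (frac_repr x); apply: adjoin_mul (Sp _) (adjoin_inv (Sp _)).
Qed.

(** The no-name lemma for the permutation module spanned by the y_i inside the
    regular one. The exponents of the monomial t = prod y_i^i are distinct, so a
    group element is determined by its action on t. The b k form a K(y)-basis of
    the space of linear forms in the x_g; working modulo the y_i by means of the
    cokernel of A selects the n - d of them that complete the y_i to a basis. *)
Lemma no_name : exists b : seq L,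
  [/\ (size b + d = n)%N, forall x, x \in b -> x \in @noether_field K gT
    & forall x, adj (mem_of ([seq y i | i <- enum 'I_d] ++ b)) x].
Proof.
set ys := [seq y i | i <- _]; pose E := subadjoin iota (mem_of ys).
have ysE i : y i \in adjoinb iota (mem_of ys).
  by apply/adjoinbP/adjoin_gen/map_f; rewrite mem_enum.
pose t := \prod_i y i ^+ i.
pose expo g := [multinom ((rho g)^-1%g j : nat) | j < d].
have Dt g : frac_act g t = mmap iota y 'X_[expo g].
  rewrite mmapX /mmap1 rmorph_prod /= (reindex_inj (@perm_inj _ (rho g)^-1%g)) /=.
  apply: eq_bigr => i _; rewrite rmorphXn /= frac_act_orbit_var permKV.
  by rewrite mnmE.
have t_inj : injective (fun g => frac_act g t).
  move=> g h /eqP; rewrite !Dt -subr_eq0 -rmorphB /= => /eqP/mmap_orbit_var_eq0/eqP.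
  rewrite subr_eq0 => /eqP /mpolyP/(_ (expo g)); rewrite !mcoeffX eqxx.
  case: eqP => [/mnmP eq_gh _ | _ /eqP]; last by rewrite oner_eq0.
  apply: rho_inj; apply: invg_inj; apply/permP=> j; apply: val_inj.
  by have /esym := eq_gh j; rewrite !mnmE.
have tE g : frac_act g t \in adjoinb iota (mem_of ys).
  rewrite Dt mmapX; apply: rpred_prod => i _; apply: rpredX; apply: ysE.
pose th g : E := SubAdjoin (tE g).
pose M : 'M[E]_n := \matrix_(k, j) th (enum_val j) ^+ k.
have M_unit : M \in unitmx.
  have -> : M = Vandermonde n (\row_j th (enum_val j)).
    by apply/matrixP=> i j; rewrite !mxE.
  rewrite unitmxE det_Vandermonde unitfE; apply/prodf_neq0 => i _.
  apply/prodf_neq0 => j ltij; rewrite !mxE subr_eq0.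
  apply: contraTneq ltij => /(congr1 val) /= /t_inj /enum_val_inj ->.
  by rewrite ltnn.
pose A : 'M[E]_(d, n) := \matrix_(i, j) (pt (enum_val j) == i)%:R.
have A_free : row_free A.
  apply/row_freeP; exists (\matrix_(j, i) (enum_val j == rep i)%:R).
  apply/matrixP=> i k; rewrite !mxE (bigD1 (enum_rank (rep k))) //= !mxE.
  rewrite enum_rankK repK eqxx mulr1 big1 ?addr0 ?[_ == i]eq_sym // => j jk.
  rewrite !mxE (_ : (_ == rep k) = false) ?mulr0 //; apply: contraNF jk => /eqP <-.
  by rewrite enum_valK.
pose C := M *m cokermx A; pose f := maxrankfun C.
have rC : \rank C = (n - d)%N.
  rewrite eqmxMfull ?row_full_unit // mxrank_coker.
  by rewrite (eqP A_free).
have le_dn : (d <= n)%N by rewrite -(eqP A_free) rank_leq_col.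
pose N := col_mx A (rowsub f M).
have N_full : row_full N.
  have N_free : row_free N.
    rewrite -kermx_eq0; apply/eqP/row_matrixP=> i; rewrite row0.
    have := sub_kermxP (row_sub i (kermx N)); rewrite -[row i _]hsubmxK.
    move: (lsubmx _) (rsubmx _) => u v; rewrite mul_row_col => uv0.
    have v0 : v = 0.
      have : v *m rowsub f C = 0.
        rewrite /C -mul_rowsub_mx mulmxA -[LHS]add0r -[X in X + _](mulmx0 _ u).
        by rewrite -[X in u *m X](mulmx_coker A) mulmxA -mulmxDl uv0 mul0mx.
      by move/eqP; rewrite mulmx_free_eq0 ?maxrowsub_free // => /eqP.
    have u0 : u = 0.
      move/eqP: uv0; rewrite v0 mul0mx addr0 mulmx_free_eq0 // => /eqP //.
    by rewrite u0 v0 row_mx0.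
  by rewrite /row_full (eqP N_free) rC subnKC.
have [B BN] := row_fullP N_full.
pose val_of := @adjoin_val _ _ iota (mem_of ys).
pose X : 'cV[L]_n := \col_j frac_var K (enum_val j).
pose b k : L := \sum_g frac_act g t ^+ k * frac_var K g.
exists [seq b (f k) | k <- enum 'I_(\rank C)]; split.
- by rewrite size_map size_enum_ord rC subnK.
- move=> _ /mapP[k _ ->]; apply/noether_fieldP => h.
  rewrite rmorph_sum /= [RHS](reindex_inj (mulgI h)) /=.
  apply: eq_bigr => g _.
  by rewrite rmorphM rmorphXn /= frac_actM frac_act_var.
apply: adjoin_frac_var => g; set s := _ ++ _.
have -> : frac_var K g = X (enum_rank g) 0 by rewrite mxE enum_rankK.
have -> : X = map_mx val_of B *m (map_mx val_of N *m X).
  by rewrite mulmxA -map_mxM BN map_mx1 mul1mx.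
rewrite mxE; apply/adjoinbP/rpred_sum => k _; apply: rpredM.
  rewrite mxE; apply/adjoinbP.
  by apply: adjoin_mono (adjoin_valP _) => z; rewrite /s mem_cat => ->.
have DX (F : gT -> L) : \sum_j F (enum_val j) * X j 0 = \sum_h F h * frac_var K h.
  rewrite [RHS](reindex (@enum_val gT predT)) /=; last first.
    by exists enum_rank => ? _; rewrite ?enum_rankK ?enum_valK.
  by apply: eq_bigr => j _; rewrite mxE.
apply/adjoinbP/adjoin_gen; rewrite /s mem_cat map_col_mx mul_col_mx mxE.
case: splitP => j _; apply/orP; [left | right]; apply/mapP; exists j; rewrite ?mem_enum //.
  rewrite mxE; transitivity (\sum_h val_of (pt h == j)%:R * frac_var K h).
    by rewrite -(DX (fun h => val_of (pt h == j)%:R)); apply: eq_bigr => l _; rewrite !mxE.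
  rewrite /orbit_var /orbit_poly rmorph_sum /= [RHS]big_mkcond.
  by apply: eq_bigr => h _; case: eqP => _; rewrite ?rmorph1 ?mul1r ?rmorph0 ?mul0r.
rewrite mxE; transitivity (\sum_h val_of (th h ^+ f j) * frac_var K h).
  by rewrite -(DX (fun h => val_of (th h ^+ f j))); apply: eq_bigr => l _; rewrite !mxE.
by apply: eq_bigr => h _; rewrite /val_of rmorphXn.
Qed.

End NoName.

(** * The symmetric group *)

Section AdjoinClosure.

Variables (K L : fieldType) (iota : {rmorphism K -> L}).
Local Notation adj := (adjoin iota).

Lemma adjoin_opp S x : adj S x -> adj S (- x).
Proof. by move=> Sx; rewrite -sub0r; apply: adjoin_sub (adjoin0 _ _) Sx. Qed.

Lemma adjoin_add S x y : adj S x -> adj S y -> adj S (x + y).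
Proof. by move=> Sx Sy; rewrite -[y]opprK; apply/adjoin_sub/adjoin_opp. Qed.

Lemma adjoin_nat S m : adj S m%:R.
Proof. by rewrite -(rmorph_nat iota); apply: adjoin_base. Qed.

Lemma adjoin_exp S x m : adj S x -> adj S (x ^+ m).
Proof. by move=> /adjoinbP Sx; apply/adjoinbP/rpredX. Qed.

(** Exact division by a monic polynomial does not leave the field of
    coefficients. *)
Lemma adj_poly_divXsubC S a (q : {poly L}) :
  adj S a -> adj_poly iota S (('X - a%:P) * q) -> adj_poly iota S q.
Proof.
move=> /adjoin_valE[a' ->] /adj_polyE[p' Dp].
have Xa : 'X - (adjoin_val a')%:P = map_poly (@adjoin_val _ _ iota S) ('X - a'%:P).
  by rewrite rmorphB /= map_polyX map_polyC.
have -> : q = map_poly (@adjoin_val _ _ iota S) (p' %/ ('X - a'%:P)).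
  by rewrite map_divp -Xa -Dp mulKp // polyXsubC_eq0.
exact: adj_poly_map.
Qed.

End AdjoinClosure.

Ltac adj_closed := repeat first
  [ assumption
  | apply: adjoin1 | apply: adjoin0 | apply: adjoin_nat
  | (apply: adjoin_gen; rewrite /= ?inE ?eqxx ?orbT; done)
  | apply: adjoin_add | apply: adjoin_opp | apply: adjoin_mul
  | apply: adjoin_inv | apply: adjoin_exp ].

Section Symmetric.

Variables (K : fieldType) (gT : finGroupType) (d : nat).
Variables (pt : gT -> 'I_d) (rho : gT -> 'S_d) (rep : 'I_d -> gT).
Hypothesis repK : cancel rep pt.
Hypothesis ptM : forall h g, pt (h * g)%g = rho h (pt g).
Hypothesis rho_inj : injective rho.

Local Notation cst := (@frac_const K gT).
Local Notation adj := (adjoin cst).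
Local Notation mem_of s := (fun x => x \in s).
Local Notation y := (orbit_var K pt).

Lemma orbit_var_inj : injective y.
Proof.
move=> i j /eqP; rewrite -subr_eq0 => /eqP yij; apply/eqP/negPn/negP => ij.
have := @mmap_orbit_var_eq0 K _ _ _ _ repK ('X_i - 'X_j).
rewrite rmorphB /= !mmapX !mmap1U => /(_ yij)/eqP; rewrite subr_eq0 => /eqP.
move=> /mpolyP/(_ U_(i)%MM); rewrite !mcoeffXU eqxx eq_sym (negPf ij) => /eqP.
by rewrite oner_eq0.
Qed.

(** The product P k of the 'X - y_i for i >= k has coefficients in the field
    generated by the elementary symmetric functions and the y_j with j < k. The
    transpositions of k with the larger indices send y_k to all its roots. *)
Lemma noether_symmetric :
  (forall s, exists g, rho g = s) -> noether_problem K gT.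
Proof.
move=> rho_surj; have [b [szb b_inv gen_b]] := no_name K repK ptM rho_inj.
have [elt rho_elt] := boolp.choice rho_surj.
pose ys := [seq y i | i <- enum 'I_d].
have szys : size ys = d by rewrite size_map size_enum_ord.
have nth_ys (i : 'I_d) : ys`_i = y i.
  by rewrite (nth_map i) ?size_enum_ord // nth_ord_enum.
have take_ys k z : z \in take k ys -> exists2 j : 'I_d, (j < k)%N & z = y j.
  rewrite -map_take => /mapP[j jk ->]; exists j => //.
  move: jk; rewrite -(mem_map val_inj) map_take val_enum_ord take_iota mem_iota.
  by rewrite add0n leq_min => /andP[_ /andP[]].
pose P k := \prod_(z <- drop k ys) ('X - z%:P).
pose c := [seq (P 0%N)`_i | i <- iota 0 d].
have P0E : P 0%N = \prod_i ('X - (y i)%:P).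
  by rewrite /P drop0 big_map -big_enum.
have c_inv z : z \in c -> z \in @noether_field K gT.
  move=> /mapP[i _ ->]; apply/noether_fieldP => h; rewrite -[LHS](coef_map (frac_act h)).
  congr ((_ : {poly _})`_i); rewrite P0E rmorph_prod /=.
  rewrite [RHS](reindex_inj (@perm_inj _ (rho h))); apply: eq_bigr => j _ /=.
  by rewrite rmorphB /= map_polyX map_polyC /= (frac_act_orbit_var _ ptM).
pose S k z := z \in take k ys ++ c ++ b.
have PS k : (k <= d)%N -> adj_poly cst (S k) (P k).
  elim: k => [|k IHk] ltk.
    move=> i; have [ltid | ] := ltnP i d.
      apply: adjoin_gen; rewrite /S take0 /= mem_cat; apply/orP; left.
      by apply/mapP; exists i; rewrite // mem_iota add0n.
    rewrite leq_eqVlt => /orP[/eqP <- | ltdi]; last first.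
      rewrite nth_default; first exact: adjoin0.
      by rewrite size_prod_XsubC drop0 szys.
    have /monicP : P 0%N \is monic by apply: monic_prod_XsubC.
    rewrite lead_coefE size_prod_XsubC drop0 szys /= => ->; exact: adjoin1.
  have Pk : P k = ('X - (ys`_k)%:P) * P k.+1 by rewrite /P (drop_nth 0) ?szys // big_cons.
  apply: (@adj_poly_divXsubC _ _ _ _ ys`_k).
    apply: adjoin_gen; rewrite /S (take_nth 0) ?szys // mem_cat mem_rcons inE eqxx.
    by [].
  rewrite -Pk; apply: adj_poly_mono (IHk (ltnW ltk)); apply: adjoin_mono => z.
  rewrite /S (take_nth 0) ?szys // !mem_cat mem_rcons inE => /or3P[]->; by rewrite ?orbT.
have step k x : (k < d)%N -> x \in @noether_field K gT -> adj (S k.+1) x -> adj (S k) x.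
  move=> ltk x_inv Sx; pose ik := Ordinal ltk.
  have ltki (i : 'I_(d - k)) : (k + i < d)%N by rewrite -ltn_subRL.
  pose g i := elt (tperm ik (Ordinal (ltki i))).
  have gw i : frac_act (g i) (y ik) = y (Ordinal (ltki i)).
    by rewrite (frac_act_orbit_var _ ptM) rho_elt tpermL.
  apply: (@adjoin_fixed_step _ _ cst _ (y ik) (P k) (d - k) (fun i => frac_act (g i))).
  - by rewrite monic_neq0 // monic_prod_XsubC.
  - by rewrite size_prod_XsubC size_drop szys.
  - exact/PS/ltnW.
  - by rewrite root_prod_XsubC (drop_nth 0) ?szys // -nth_ys inE eqxx.
  - by move=> i a; apply: frac_act_const.
  - move=> i z; rewrite !mem_cat => /orP[/take_ys[j ltj ->] | z_inv].
      rewrite /= (frac_act_orbit_var _ ptM) rho_elt tpermD //.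
        by rewrite neq_ltn ltj orbT.
      by rewrite neq_ltn /= ltn_addr ?orbT.
    have : z \in @noether_field K gT by case/orP: z_inv; [apply: c_inv | apply: b_inv].
    by move/noether_fieldP => zg; apply: zg.
  - by move=> i j /=; rewrite !gw => /orbit_var_inj/(congr1 val)/= /addnI/val_inj.
  - apply: adjoin_mono Sx => z.
    by rewrite /S (take_nth 0) ?szys // -(nth_ys ik) !(mem_cat, mem_rcons, inE) -!orbA.
  by move=> i; move/noether_fieldP: x_inv => x_g; apply: x_g.
apply: (@noether_criterion _ _ (c ++ b)).
- by rewrite size_cat size_map size_iota addnC szb.
- by move=> z; rewrite mem_cat => /orP[]; [apply: c_inv | apply: b_inv].
move=> x x_inv; have : adj (S 0%N) x; last by apply: adjoin_mono => z; rewrite /S take0.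
have : adj (S d) x.
  apply: adjoin_mono (gen_b x) => z; rewrite /S take_oversize ?szys // !mem_cat.
  by case/orP=> ->; rewrite ?orbT.
by elim: {-2}d (leqnn d) => // k IHk ltk /(step k x ltk x_inv); apply/IHk/ltnW.
Qed.

End Symmetric.

(** * Quadratic, cubic and dihedral descent *)

Section Descent.

Variables (K L : fieldType) (cst : {rmorphism K -> L}) (gT : finGroupType).
Variable act : gT -> {rmorphism L -> L}.
Hypothesis act1 : forall x, act 1%g x = x.
Hypothesis actM : forall h g x, act h (act g x) = act (h * g)%g x.
Hypothesis act_cst : forall h a, act h (cst a) = cst a.

Local Notation adj := (adjoin cst).
Local Notation mem_of s := (fun x => x \in s).
Local Notation fixed x := (forall h, act h x = x).
Implicit Types (x w : L) (g h : gT).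

(** The case of degree 2: w is a square root over the field generated by s, and
    h is its conjugation. The family t may be any elements of the upper field. *)
Lemma quadratic_step (s t : seq L) w h x :
    w ^+ 2 \in adjoinb cst (mem_of s) -> w != - w ->
    (forall z, z \in s -> act h z = z) -> act h w = - w ->
    act h x = x -> (forall z, z \in t -> adj (mem_of (w :: s)) z) ->
  adj (mem_of t) x -> adj (mem_of s) x.
Proof.
move=> /adjoinbP sw2 w_neq hs hw hx ts tx.
pose g (i : 'I_2) : gT := if val i == 0%N then 1%g else h.
have gP z (i : 'I_2) : act (g i) z = if val i == 0%N then z else act h z.
  by rewrite /g; case: eqP => // _; apply: act1.
apply: (@adjoin_fixed_step _ _ cst s w ('X^2 - (w ^+ 2)%:P) 2 (fun i => act (g i))).
- by rewrite -size_poly_eq0 size_XnsubC.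
- by rewrite size_XnsubC.
- apply: adj_polyB (adj_polyC sw2); rewrite expr2.
  by apply: adj_polyM; apply: adj_polyX.
- by rewrite rootE !hornerE subrr.
- by move=> i a; apply: act_cst.
- by move=> i z /hs hz; rewrite /= gP hz if_same.
- move=> [[|[|i]] Hi] [[|[|j]] Hj] //=; rewrite !gP /= ?hw => E; try exact: val_inj.
    by rewrite {1}E eqxx in w_neq.
  by rewrite -{1}E eqxx in w_neq.
- exact: adjoin_trans tx.
by move=> i; rewrite /= gP hx if_same.
Qed.

(** Over a field containing e1, A = Q / P and B = D / P the elements a, b, c
    generate a cyclic cubic extension. The identity 4 P^3 = Q^2 + 27 D^2 (D^2 is
    the discriminant) reads 4 P = A^2 + 27 B^2, so e1, A, B determine P, then
    Q = A P and D = B P, and finally e2 and e3: for independent a, b, c the field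
    of C_3-invariants of K(a, b, c) is K(e1, A, B). In terms of the Lagrange resolvents r and r' of
    a, b, c, A is r^2 / r' + r'^2 / r, and B is the difference of these two
    quotients divided by a multiple of the square root of -3; the combination
    exists without a cube root of unity in K. *)
Lemma cubic_step (s : seq L) a b c h x :
    (2%:R : L) != 0 -> (3%:R : L) != 0 ->
    let e1 := a + b + c in let e2 := a * b + b * c + c * a in
    let e3 := a * b * c in let P := e1 ^+ 2 - 3%:R * e2 in
    let Q := 2%:R * e1 ^+ 3 - 9%:R * e1 * e2 + 27%:R * e3 in
    let D := (a - b) * (b - c) * (c - a) in
    P != 0 -> a != b -> b != c -> c != a ->
    e1 \in s -> Q / P \in s -> D / P \in s ->
    (forall z, z \in s -> act h z = z) ->
    act h a = b -> act h b = c -> act h c = a ->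
    act h x = x ->
  adj (mem_of [:: a, b, c & s]) x -> adj (mem_of s) x.
Proof.
move=> n2 n3 e1 e2 e3 P Q D P0 ab bc ca s_e1 sA sB hs ha hb hc hx sx.
have n4 : (4%:R : L) != 0 by rewrite (natrM _ 2 2) mulf_neq0.
have n27 : (27%:R : L) != 0 by rewrite (natrM _ 3 9) (natrM _ 3 3) !mulf_neq0.
pose A := Q / P; pose B := D / P.
have DP : P = (A ^+ 2 + 27%:R * B ^+ 2) / 4%:R.
  rewrite /A /B /D /Q; move: P0; rewrite /P /e1 /e2 /e3 => P0; field.
  by rewrite P0 n4.
have adj_e1 : adj (mem_of s) e1 by apply: adjoin_gen.
have adjA : adj (mem_of s) A by apply: adjoin_gen.
have adjB : adj (mem_of s) B by apply: adjoin_gen.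
have adjP : adj (mem_of s) P by rewrite DP; adj_closed.
have adj_e2 : adj (mem_of s) e2.
  have -> : e2 = (e1 ^+ 2 - P) / 3%:R by rewrite /P; field.
  by adj_closed.
have adj_e3 : adj (mem_of s) e3.
  have -> : e3 = (A * P - 2%:R * e1 ^+ 3 + 9%:R * e1 * e2) / 27%:R.
    by rewrite /A divfK // /Q; field.
  by adj_closed.
have adjD : adj (mem_of s) D by rewrite -[D](divfK P0); adj_closed.
clear DP; pose p : {poly L} := ('X - a%:P) * ('X - b%:P) * ('X - c%:P).
have Dp : p = (('X - e1%:P) * 'X - (- e2)%:P) * 'X - e3%:P.
  by rewrite /p /e1 /e2 /e3 !(rmorphN, rmorphD, rmorphM) /=; ring.
pose g (i : 'I_3) := (h ^+ val i)%g.
have g0 z : act (h ^+ 0)%g z = z by rewrite expg0 act1.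
have gS z k : act (h ^+ k.+1)%g z = act (h ^+ k)%g (act h z).
  by rewrite actM expgSr.
have g_fix z : act h z = z -> forall i, act (g i) z = z.
  move=> hz i; rewrite /g; elim: (val i) => [|k IHk]; first exact: g0.
  by rewrite gS hz.
apply: (@adjoin_fixed_step _ _ cst s a p 3 (fun i => act (g i))).
- by rewrite monic_neq0 // !monicMl ?monicXsubC.
- have -> : p = \prod_(z <- [:: a; b; c]) ('X - z%:P).
    by rewrite !big_cons big_nil mulr1 mulrA.
  by rewrite size_prod_XsubC.
- have SX := adj_polyX cst (mem_of s).
  rewrite Dp; apply: adj_polyB; last exact: adj_polyC.
  apply: adj_polyM => //; apply: adj_polyB; last exact/adj_polyC/adjoin_opp.
  by apply: adj_polyM => //; apply: adj_polyB => //; apply: adj_polyC.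
- by rewrite rootE !hornerE subrr !mul0r.
- by move=> i z; apply: act_cst.
- by move=> i z /hs hz; apply: g_fix.
- have ab' := ab; rewrite eq_sym in ab'.
  have bc' := bc; rewrite eq_sym in bc'.
  have ca' := ca; rewrite eq_sym in ca'.
  move=> [[|[|[|i]]] Hi] [[|[|[|j]]] Hj] //=; rewrite /g /= !(gS, g0) ?(ha, hb, hc) => E;
    try (exact: val_inj);
    by [rewrite E eqxx in ab | rewrite E eqxx in bc | rewrite E eqxx in ca
       | rewrite E eqxx in ab' | rewrite E eqxx in bc' | rewrite E eqxx in ca'].
- have adj_a : adj (mem_of (a :: s)) a by apply: adjoin_gen; rewrite inE eqxx.
  have up z : adj (mem_of s) z -> adj (mem_of (a :: s)) z.
    by apply: adjoin_mono => u su; rewrite inE su orbT.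
  move/up: adj_e1 => adj_e1; move/up: adj_e2 => adj_e2; move/up: adjD => adjD.
  have q0 : 3%:R * a ^+ 2 - 2%:R * e1 * a + e2 != 0.
    rewrite (_ : _ + _ = (a - b) * (a - c)); last by rewrite /e1 /e2; ring.
    by rewrite mulf_neq0 // ?subr_eq0 // eq_sym.
  (* The sum b + c is e1 - a, and the difference b - c is D divided by
     - (a - b) (a - c), the derivative at a of the polynomial p up to sign. *)
  have adj_b : adj (mem_of (a :: s)) b.
    have -> : b = (e1 - a - D / (3%:R * a ^+ 2 - 2%:R * e1 * a + e2)) / 2%:R.
      rewrite /D; move: q0; rewrite /e1 /e2 => q0; field.
      by rewrite n2 q0.
    by adj_closed.
  have adj_c : adj (mem_of (a :: s)) c.
    have -> : c = e1 - a - b by rewrite /e1; ring.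
    by adj_closed.
  apply: adjoin_trans sx => z /=; rewrite !inE => /or4P[/eqP-> | /eqP-> | /eqP-> | sz] //.
  by apply/up/adjoin_gen.
by move=> i; apply: g_fix.
Qed.

Variables (U A B : bool -> L).

(** The bit s tells whether g swaps the two blocks, and e i is the sign that g
    gives to B i. *)
Definition signed_type g (s : bool) (e : bool -> bool) := forall i,
  [/\ act g (U i) = U (i (+) s), act g (A i) = A (i (+) s)
    & act g (B i) = (-1) ^+ e i * B (i (+) s)].

Lemma signed_typeM g h s s' e e' :
    signed_type h s e -> signed_type g s' e' ->
  signed_type (h * g) (s (+) s') (fun i => e' i (+) e (i (+) s')).
Proof.
move=> hP gP i; have [gU gA gB] := gP i; have [hU hA hB] := hP (i (+) s').
have -> : i (+) (s (+) s') = (i (+) s') (+) s by rewrite [s (+) s']addbC addbA.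
rewrite -!actM gU gA gB hU hA; split=> //.
by rewrite rmorphM rmorphXn rmorphN1 /= hB mulrA -signr_addb.
Qed.

Hypothesis char2 : (2%:R : L) != 0.
Hypothesis B_neq0 : forall i, B i != 0.
Hypothesis Bp_neq0 : B false ^+ 2 + B true ^+ 2 != 0.
Hypothesis Bq_neq0 : B false ^+ 2 - B true ^+ 2 != 0.
Hypothesis signed : forall g, exists s e, signed_type g s e.
Hypothesis swapped : exists h e, signed_type h true e.

(** The group acts on the pair B through a subgroup of the dihedral group of
    order 8 that contains a swap; up to conjugacy there are four such subgroups.
    In each case two invariants of the action on the pair B generate its fixed
    field, and the differences of the U and of the A become invariant after
    multiplication by a function of the pair B that also changes sign under the
    swap. The descent is a tower of quadratic steps. *)
Lemma signed_descent (b : seq L) :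
    (forall x, x \in b -> fixed x) ->
  exists c : seq L, [/\ size c = 6, forall x, x \in c -> fixed x
    & forall x, fixed x ->
      adj (mem_of ([:: U false; U true; A false; A true; B false; B true] ++ b)) x ->
      adj (mem_of (c ++ b)) x].
Proof.
move=> b_inv.
set t := [:: _; _; _; _; _; _] ++ b.
set U0 := U false in t *; set U1 := U true in t *.
set A0 := A false in t *; set A1 := A true in t *.
set B0 := B false in t *; set B1 := B true in t *.
have neq_opp w : w != 0 -> w != - w.
  by move=> w0; rewrite -addr_eq0 -mulr2n -mulr_natl mulf_neq0.
have [B0n B1n] : B0 != 0 /\ B1 != 0 by split; apply: B_neq0.
pose q := B0 ^+ 2 - B1 ^+ 2; pose m := B0 * B1.
have pn : B0 ^+ 2 + B1 ^+ 2 != 0 := Bp_neq0.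
have qn : q != 0 := Bq_neq0.
have mn : m != 0 by rewrite mulf_neq0.
have typeE g s e : signed_type g s e ->
  [/\ act g U0 = U s, act g A0 = A s & act g B0 = (-1) ^+ e false * B s] /\
  [/\ act g U1 = U (~~ s), act g A1 = A (~~ s) & act g B1 = (-1) ^+ e true * B (~~ s)].
  by move=> gP; split; [apply: (gP false) | apply: (gP true)].
(* If v changes sign exactly when the blocks are swapped, then (V0 - V1) * v is
   invariant, and together with V0 + V1 and v it determines V0 and V1. *)
have split_pair S V0 V1 v : v != 0 ->
    adj S (V0 + V1) -> adj S ((V0 - V1) * v) -> adj S v -> adj S V0 /\ adj S V1.
  move=> v0 sum_S dif_S v_S.
  have SV0 : adj S V0.
    have -> : V0 = ((V0 + V1) + (V0 - V1) * v / v) / 2%:R by field; rewrite v0 char2.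
    by adj_closed.
  by split=> //; have -> : V1 = (V0 + V1) - V0 by [ring]; adj_closed.
pose cs c3 c4 v :=
  [:: U0 + U1; A0 + A1; c3; c4; (U0 - U1) * v; (A0 - A1) * v] ++ b.
have tP S : adj S U0 /\ adj S U1 -> adj S A0 /\ adj S A1 -> adj S B0 -> adj S B1 ->
    (forall z, z \in b -> adj S z) -> forall z, z \in t -> adj S z.
  move=> [SU0 SU1] [SA0 SA1] SB0 SB1 Sb z.
  rewrite !mem_cat !inE -!orbA.
  by do 6?[case/orP=> [/eqP-> // |]]; apply: Sb.
have csP c3 c4 v S : v != 0 -> (forall z, z \in cs c3 c4 v -> adj S z) -> adj S v ->
    adj S B0 -> adj S B1 -> forall z, z \in t -> adj S z.
  move=> v0 Scs Sv SB0 SB1; have Sc z : z \in cs c3 c4 v -> adj S z by apply: Scs.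
  apply: tP => // [||z bz].
  - by apply: split_pair v0 _ _ Sv; apply: Sc; rewrite !inE eqxx ?orbT.
  - by apply: split_pair v0 _ _ Sv; apply: Sc; rewrite !inE eqxx ?orbT.
  by apply: Sc; rewrite mem_cat bz orbT.
(* Each case below supplies two invariants c3, c4 built from B0 and B1 and an
   element v on which the group acts through the swap character. *)
have build c3 c4 v :
    (forall g, act g c3 = c3 /\ act g c4 = c4) ->
    (forall g s e, signed_type g s e -> act g v = (-1) ^+ s * v) ->
    ((forall g z, z \in cs c3 c4 v -> act g z = z) ->
     forall x, (forall g, act g x = x) -> adj (mem_of t) x ->
       adj (mem_of (cs c3 c4 v)) x) ->
  exists c : seq L, [/\ size c = 6, forall x, x \in c -> fixed x
    & forall x, fixed x -> adj (mem_of t) x -> adj (mem_of (c ++ b)) x].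
  move=> c34_inv v_sgn descent; exists (take 6 (cs c3 c4 v)).
  have c_inv z : z \in take 6 (cs c3 c4 v) -> fixed z.
    move=> cz g; have [c3g c4g] := c34_inv g.
    have [s [e gP]] := signed g; have vg := v_sgn _ _ _ gP.
    have [[gU0 gA0 _] [gU1 gA1 _]] := typeE _ _ _ gP.
    move: cz; rewrite /= take0 !inE.
    do 5?[case/orP=> [/eqP->|]]; try move/eqP->; rewrite // !(rmorphM, rmorphB, rmorphD) /=;
      rewrite ?vg ?gU0 ?gU1 ?gA0 ?gA1; case: (s); rewrite /= -/U0 -/U1 -/A0 -/A1; ring.
  have cs_inv g z : z \in cs c3 c4 v -> act g z = z.
    rewrite -(cat_take_drop 6 (cs c3 c4 v)) mem_cat => /orP[/c_inv | ].
      exact.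
    by rewrite /= drop0 => /b_inv.
  split; [by rewrite /= take0 | exact: c_inv | move=> x x_inv tx; rewrite /= take0].
  exact: (descent cs_inv x x_inv tx).
have up c3 c4 v r z : z \in cs c3 c4 v -> adj (mem_of (r ++ cs c3 c4 v)) z.
  by move=> cz; apply: adjoin_gen; rewrite mem_cat cz orbT.
have q_sgn h s f : signed_type h s f -> act h q = (-1) ^+ s * q.
  move=> hP; have [[_ _ hB0] [_ _ hB1]] := typeE _ _ _ hP.
  rewrite /q rmorphB !rmorphXn /= hB0 hB1 -/B0 -/B1.
  by case: s {hP hB0 hB1}; case: (f false); case: (f true) => /=; rewrite -/B0 -/B1; ring.
have [h0 [e0 h0P]] := swapped.
(* Some element changes the sign of just one of B0, B1: with the swap it
   generates the whole dihedral group, whose invariants are B0^2 + B1^2 and q^2. *)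
have [[g [e [gP e_odd]]] | no_d] := boolp.pselect (exists g e,
    signed_type g false e /\ e false (+) e true).
  have conjP : signed_type (h0 * g * h0^-1)%g false (fun i => e (~~ i)).
    move=> i; have [hU hA hB] := h0P (~~ i); rewrite addbT negbK in hU hA hB.
    have [gU gA gB] := gP (~~ i); rewrite addbF in gU gA gB.
    rewrite addbF -!actM; split.
    - by rewrite -hU [act _^-1%g _]actM mulVg act1 gU.
    - by rewrite -hA [act _^-1%g _]actM mulVg act1 gA.
    have DB : B i = (-1) ^+ e0 (~~ i) * act h0 (B (~~ i)) by rewrite hB signrMK.
    rewrite DB !(rmorphM, rmorphXn, rmorphN1) /= [act _^-1%g _]actM.
    by rewrite mulVg act1 gB !(rmorphM, rmorphXn, rmorphN1) /= mulrCA.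
  have [[d1 [e1 [d1P e1f e1t]]] [d2 [e2 [d2P e2f e2t]]]] :
      (exists d1 e1, [/\ signed_type d1 false e1, e1 false & ~~ e1 true]) /\
      (exists d2 e2, [/\ signed_type d2 false e2, ~~ e2 false & e2 true]).
    have [ef | ef] := boolP (e false); rewrite ?ef ?(negPf ef) /= in e_odd.
      split; first by exists g, e.
      by eexists; eexists; split; first exact: conjP.
    split; last by exists g, e.
    by eexists; eexists; split; first exact: conjP.
  have [[_ _ d1B0] [_ _ d1B1]] := typeE _ _ _ d1P.
  have [[_ _ d2B0] [_ _ d2B1]] := typeE _ _ _ d2P.
  rewrite e1f mulN1r in d1B0; rewrite (negPf e1t) mul1r in d1B1.
  rewrite (negPf e2f) mul1r in d2B0; rewrite e2t mulN1r in d2B1.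
  apply: (build (B0 ^+ 2 + B1 ^+ 2) (q ^+ 2) q).
  - move=> h; have [s [f hP]] := signed h; have [[_ _ hB0] [_ _ hB1]] := typeE _ _ _ hP.
    rewrite rmorphD !rmorphXn /= (q_sgn _ _ _ hP) hB0 hB1 -/B0 -/B1.
    split; last by case: (s); rewrite /=; ring.
    by case: s {hP hB0 hB1}; case: (f false); case: (f true) => /=; rewrite -/B0 -/B1; ring.
  - exact: q_sgn.
  set c := cs _ _ _ => c_inv x x_inv tx.
  have c_p r : adj (mem_of (r ++ c)) (B0 ^+ 2 + B1 ^+ 2).
    by apply: up; rewrite !inE eqxx ?orbT.
  have c_q2 r : adj (mem_of (r ++ c)) (q ^+ 2) by apply: up; rewrite !inE eqxx ?orbT.
  apply: (@quadratic_step c (q :: c) q h0) (x_inv _) _ _.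
  - exact/adjoinbP/(c_q2 [::]).
  - exact: neq_opp.
  - exact: c_inv.
  - by rewrite (q_sgn _ _ _ h0P) mulN1r.
  - by move=> z cz; apply: adjoin_gen.
  apply: (@quadratic_step (q :: c) (B0 :: q :: c) B0 d1) (x_inv _) _ _.
  - apply/adjoinbP; have := c_p [:: q]; rewrite /= => c_p'.
    have -> : B0 ^+ 2 = ((B0 ^+ 2 + B1 ^+ 2) + q) / 2%:R by rewrite /q; field.
    by adj_closed.
  - exact: neq_opp.
  - by move=> z; rewrite inE => /orP[/eqP-> | /c_inv //]; rewrite (q_sgn _ _ _ d1P) mul1r.
  - by [].
  - by move=> z cz; apply: adjoin_gen.
  apply: (@quadratic_step (B0 :: q :: c) t B1 d2) (x_inv _) _ tx.
  - apply/adjoinbP; have -> : B1 ^+ 2 = B0 ^+ 2 - q by rewrite /q; ring.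
    by adj_closed.
  - exact: neq_opp.
  - move=> z; rewrite !inE => /or3P[/eqP-> // | /eqP-> | /c_inv //].
    by rewrite (q_sgn _ _ _ d2P) mul1r.
  - by [].
  apply: (csP (B0 ^+ 2 + B1 ^+ 2) (q ^+ 2) q); rewrite ?qn //; last 3 first.
  - by adj_closed.
  - by adj_closed.
  - by adj_closed.
  by move=> z cz; apply: (up _ _ _ [:: B1; B0; q] _ cz).
have even_e g e : signed_type g false e -> e false = e true.
  move=> gP; apply/eqP/negPn/negP => neq_e; case: no_d; exists g, e.
  by split=> //; case: (e false) neq_e; case: (e true).
have swap_e g e : signed_type g true e -> e false (+) e true = e0 false (+) e0 true.
  move=> gP; have /even_e := signed_typeM gP h0P.
  by rewrite /=; case: (e false); case: (e true); case: (e0 false); case: (e0 true).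
(* The swap h0 acts on the plane of B0, B1 as a rotation of order 4, up to the
   other swaps: the image of the group is cyclic of order 4, m = B0 * B1 and q
   both carry the swap character, and h0 * h0 acts as -1. *)
have [e0_eq | e0_neq] := eqVneq (e0 false) (e0 true); last first.
  have {}swap_e g e : signed_type g true e -> e false (+) e true.
    by move/swap_e->; case: (e0 false) e0_neq; case: (e0 true).
  have m_sgn h s f : signed_type h s f -> act h m = (-1) ^+ s * m.
    move=> hP; have [[_ _ hB0] [_ _ hB1]] := typeE _ _ _ hP.
    rewrite /m rmorphM /= hB0 hB1; case: s hP {hB0 hB1} => hP /=; rewrite -/B0 -/B1.
      by have := swap_e _ _ hP; case: (f false); case: (f true) => //= _; ring.
    by have := even_e _ _ hP; case: (f false); case: (f true) => //= _; ring.
  have NP := signed_typeM h0P h0P; set N := (h0 * h0)%g in NP.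
  have [[_ _ NB0] [_ _ NB1]] := typeE _ _ _ NP.
  have /= e0_or : e0 false (+) e0 true by case: (e0 false) e0_neq; case: (e0 true).
  rewrite /= e0_or mulN1r in NB0.
  apply: (build (B0 ^+ 2 + B1 ^+ 2) (q / m) m).
  - move=> h; have [s [f hP]] := signed h; have [[_ _ hB0] [_ _ hB1]] := typeE _ _ _ hP.
    rewrite fmorph_div rmorphD !rmorphXn /= (q_sgn _ _ _ hP) (m_sgn _ _ _ hP) hB0 hB1.
    split; last by case: (s); rewrite /= ?mul1r // !mulN1r invrN mulrNN.
    by case: s {hP hB0 hB1}; case: (f false); case: (f true) => /=; rewrite -/B0 -/B1; ring.
  - exact: m_sgn.
  set c := cs _ _ _ => c_inv x x_inv tx.
  have c_p r : adj (mem_of (r ++ c)) (B0 ^+ 2 + B1 ^+ 2).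
    by apply: up; rewrite !inE eqxx ?orbT.
  have c_qm r : adj (mem_of (r ++ c)) (q / m) by apply: up; rewrite !inE eqxx ?orbT.
  apply: (@quadratic_step c (m :: c) m h0) (x_inv _) _ _.
  - apply/adjoinbP; have := c_p [::]; have := c_qm [::]; rewrite /= => c_qm' c_p'.
    (* This conic is parametrized by q / m, so that m ^+ 2 is a rational
       function of B0^2 + B1^2 and q / m. *)
    have Dm : (B0 ^+ 2 + B1 ^+ 2) ^+ 2 = ((q / m) ^+ 2 + 4%:R) * m ^+ 2.
      by rewrite /q /m; field; rewrite B0n B1n.
    have : ((q / m) ^+ 2 + 4%:R) * m ^+ 2 != 0 by rewrite -Dm expf_neq0.
    rewrite mulf_eq0 negb_or => /andP[k0 _].
    have -> : m ^+ 2 = (B0 ^+ 2 + B1 ^+ 2) ^+ 2 / ((q / m) ^+ 2 + 4%:R).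
      by rewrite Dm mulrC mulKf.
    by adj_closed.
  - exact: neq_opp.
  - exact: c_inv.
  - by rewrite (m_sgn _ _ _ h0P) mulN1r.
  - by move=> z cz; apply: adjoin_gen.
  have c_q : adj (mem_of (m :: c)) q.
    have := c_qm [:: m]; rewrite /= => c_qm'.
    rewrite -[q](divfK mn); adj_closed.
  apply: (@quadratic_step (m :: c) t B0 N) (x_inv _) _ tx.
  - apply/adjoinbP; have := c_p [:: m]; rewrite /= => c_p'.
    have -> : B0 ^+ 2 = ((B0 ^+ 2 + B1 ^+ 2) + q) / 2%:R by rewrite /q; field.
    by adj_closed.
  - exact: neq_opp.
  - by move=> z; rewrite inE => /orP[/eqP-> | /c_inv //]; rewrite (m_sgn _ _ _ NP) mul1r.
  - by [].
  apply: (csP (B0 ^+ 2 + B1 ^+ 2) (q / m) m); rewrite // ?mn //; last 3 first.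
  - by adj_closed.
  - by adj_closed.
  - have -> : B1 = m / B0 by rewrite /m; field.
    by adj_closed.
  by move=> z cz; apply: (up _ _ _ [:: B0; m] _ cz).
have {}swap_e g e : signed_type g true e -> e false = e true.
  by move/swap_e; rewrite e0_eq addbb; case: (e false); case: (e true).
(* Only simultaneous sign changes occur. If -1 occurs, the image is the Klein
   four-group, which is diagonal in the basis B0 + B1, B0 - B1. *)
have [[g [e [gP eT]]] | no_N] := boolp.pselect (exists g e,
    signed_type g false e /\ e false).
  have [h [f [hP fF]]] : exists h f, signed_type h true f /\ ~~ f false.
    have [e0F | ] := boolP (e0 false); last by exists h0, e0.
    eexists; eexists; split; first exact: (signed_typeM gP h0P).
    by rewrite /= -(even_e _ _ gP) e0F eT.
  pose sg := B0 + B1; pose w := B0 - B1.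
  have qE : q = sg * w by rewrite /q /sg /w; ring.
  have [sgn wn] : sg != 0 /\ w != 0.
    by move: qn; rewrite qE mulf_eq0 negb_or => /andP.
  have sw_sgn k s f' : signed_type k s f' ->
    act k sg = (-1) ^+ f' false * sg /\ act k w = (-1) ^+ (f' false (+) s) * w.
    move=> kP; have [[_ _ kB0] [_ _ kB1]] := typeE _ _ _ kP.
    have Df : f' false = f' true by case: (s) kP; [apply: swap_e | apply: even_e].
    rewrite /sg /w rmorphB rmorphD /= kB0 kB1 -Df.
    by case: s {kP kB0 kB1 Df}; case: (f' false) => /=; rewrite -/B0 -/B1; split; ring.
  have [gsg gw] := sw_sgn _ _ _ gP; have [hsg hw] := sw_sgn _ _ _ hP.
  rewrite eT mulN1r in gsg; rewrite (negPf fF) mul1r in hsg.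
  rewrite (negPf fF) mulN1r in hw.
  apply: (build (sg ^+ 2) (w ^+ 2) (sg * w)).
  - move=> k; have [s [f' kP]] := signed k; have [ksg kw] := sw_sgn _ _ _ kP.
    by rewrite !rmorphXn /= ksg kw !exprMn !sqrr_sign !mul1r.
  - move=> k s f' /sw_sgn[ksg kw]; rewrite rmorphM /= ksg kw mulrACA -signr_addb.
    by rewrite addKb.
  set c := cs _ _ _ => c_inv x x_inv tx.
  have c_sg r : adj (mem_of (r ++ c)) (sg ^+ 2) by apply: up; rewrite !inE eqxx ?orbT.
  have c_w r : adj (mem_of (r ++ c)) (w ^+ 2) by apply: up; rewrite !inE eqxx ?orbT.
  apply: (@quadratic_step c (sg :: c) sg g) (x_inv _) _ _ => //.
  - exact/adjoinbP/(c_sg [::]).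
  - exact: neq_opp.
  - exact: c_inv.
  - by move=> z cz; apply: adjoin_gen.
  apply: (@quadratic_step (sg :: c) t w h) (x_inv _) _ tx => //.
  - exact/adjoinbP/(c_w [:: sg]).
  - exact: neq_opp.
  - by move=> z; rewrite inE => /orP[/eqP-> | /c_inv].
  apply: (csP (sg ^+ 2) (w ^+ 2) (sg * w)); rewrite ?mulf_neq0 //; last 3 first.
  - by adj_closed.
  - have -> : B0 = (sg + w) / 2%:R by rewrite /sg /w; field.
    by adj_closed.
  - have -> : B1 = (sg - w) / 2%:R by rewrite /sg /w; field.
    by adj_closed.
  by move=> z cz; apply: (up _ _ _ [:: w; sg] _ cz).
(* The image has order 2. Its generator may be B0 <-> B1 or B0 <-> - B1; the
   sign eps brings the second case back to the first. *)
pose eps := (-1) ^+ e0 false : L.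
have eps2 : eps * eps = 1 by rewrite /eps -expr2 sqrr_sign.
pose sg := B0 + eps * B1; pose w := B0 - eps * B1.
have qE : q = sg * w.
  by rewrite mulrC /q /w /sg -subr_sqr exprMn [eps ^+ 2]eps2 mul1r.
have wn : w != 0.
  by move: qn; rewrite qE mulf_eq0 negb_or => /andP[].
have no_e k f : signed_type k false f -> f false = false /\ f true = false.
  move=> kP; have f0 : f false = false by apply: contra_notF no_N => fT; exists k, f.
  by rewrite -(even_e _ _ kP).
have swap_e0 k f : signed_type k true f -> f false = e0 false /\ f true = e0 false.
  move=> kP; have [_] := no_e _ _ (signed_typeM kP h0P).
  by rewrite /= (swap_e _ _ kP) -e0_eq; case: (e0 false); case: (f true).
have sw_sgn k s f : signed_type k s f ->
    act k sg = sg /\ act k w = (-1) ^+ s * w.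
  move=> kP; have [[_ _ kB0] [_ _ kB1]] := typeE _ _ _ kP.
  have k_eps : act k eps = eps by rewrite /eps rmorphXn rmorphN1.
  rewrite /sg /w rmorphB rmorphD rmorphM /= k_eps kB0 kB1.
  case: s {kB0 kB1} kP => kP /=; rewrite -/B0 -/B1.
    have [-> ->] := swap_e0 _ _ kP; rewrite -/eps mulrA eps2 mul1r.
    by split; ring.
  by have [-> ->] := no_e _ _ kP; rewrite expr0 !mul1r.
apply: (build sg (w ^+ 2) w).
- move=> k; have [s [f kP]] := signed k; have [ksg kw] := sw_sgn _ _ _ kP.
  by rewrite rmorphXn /= ksg kw exprMn sqrr_sign mul1r.
- by move=> k s f /sw_sgn[].
set c := cs _ _ _ => c_inv x x_inv tx.
have c_sg r : adj (mem_of (r ++ c)) sg by apply: up; rewrite !inE eqxx ?orbT.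
have c_w r : adj (mem_of (r ++ c)) (w ^+ 2) by apply: up; rewrite !inE eqxx ?orbT.
have adj_eps S : adj S eps by apply: adjoin_exp; apply/adjoin_opp/adjoin1.
apply: (@quadratic_step c t w h0) (x_inv _) _ tx => //.
- exact/adjoinbP/(c_w [::]).
- exact: neq_opp.
- exact: c_inv.
- by have [_ ->] := sw_sgn _ _ _ h0P; rewrite mulN1r.
have := c_sg [:: w]; rewrite /= => c_sg'; have := adj_eps (mem_of (w :: c)) => adj_eps'.
apply: (csP sg (w ^+ 2) w) => //; last 3 first.
- by adj_closed.
- have -> : B0 = (sg + w) / 2%:R by rewrite /sg /w; field.
  by adj_closed.
- have -> : B1 = eps * ((sg - w) / 2%:R).
    rewrite (_ : (sg - w) / 2%:R = eps * B1) ?mulrA ?eps2 ?mul1r //.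
    by rewrite /sg /w; field.
  by adj_closed.
by move=> z cz; apply: (up _ _ _ [:: w] _ cz).
Qed.

End Descent.

(** * Two blocks of three points *)

Definition blk (i : bool) (j : 'I_3) : 'I_6 :=
  if i then @rshift 3 3 j else @lshift 3 3 j.

Notation o0 := (Ordinal (isT : (0 < 3)%N)).
Notation o1 := (Ordinal (isT : (1 < 3)%N)).
Notation o2 := (Ordinal (isT : (2 < 3)%N)).

Lemma blk_inj i i' j j' : blk i j = blk i' j' -> i = i' /\ j = j'.
Proof.
have neq (u v : 'I_3) : (3 + u)%N <> v :> nat.
  by move=> uv; have := ltn_ord v; rewrite -uv -[X in (_ < X)%N]addn0 ltn_add2l.
rewrite /blk; case: i; case: i' => /(congr1 val) /=.
- by move/addnI/val_inj.
- by move/neq.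
- by move/esym/neq.
- by move/val_inj.
Qed.

Lemma blkP (k : 'I_6) : exists i j, k = blk i j.
Proof.
rewrite -[k](@splitK 3 3); case: (@split 3 3 k) => j.
  by exists false, j.
by exists true, j.
Qed.

Section Triples.

Variable R : comNzRingType.
Implicit Type f : 'I_3 -> R.

Definition tri_e1 f := f o0 + f o1 + f o2.
Definition tri_e2 f := f o0 * f o1 + f o1 * f o2 + f o2 * f o0.
Definition tri_e3 f := f o0 * f o1 * f o2.

(** The cubic with roots f 0, f 1, f 2 has the depressed form
    T^3 - 3 P T - Q for the unknown T = 3 X - e1, and D^2 is its discriminant up
    to a scalar. *)
Definition tri_P f := tri_e1 f ^+ 2 - 3%:R * tri_e2 f.
Definition tri_Q f :=
  2%:R * tri_e1 f ^+ 3 - 9%:R * tri_e1 f * tri_e2 f + 27%:R * tri_e3 f.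
Definition tri_D f := (f o0 - f o1) * (f o1 - f o2) * (f o2 - f o0).

Lemma tri_perm (p : 'I_3 -> 'I_3) f : injective p ->
  [/\ tri_e1 (f \o p) = tri_e1 f, tri_P (f \o p) = tri_P f, tri_Q (f \o p) = tri_Q f
    & exists e : bool, tri_D (f \o p) = (-1) ^+ e * tri_D f].
Proof.
move=> p_inj; rewrite /tri_P /tri_Q /tri_e1 /tri_e2 /tri_e3 /tri_D /=.
have pP j : [\/ p j = o0, p j = o1 | p j = o2].
  by case: (p j) => [[|[|[|k]]]] Hk //;
    [apply: Or31 | apply: Or32 | apply: Or33]; apply: val_inj.
have n01 : p o0 <> p o1 by move/p_inj.
have n12 : p o1 <> p o2 by move/p_inj.
have n02 : p o0 <> p o2 by move/p_inj.
have [E0 | E0 | E0] := pP o0; have [E1 | E1 | E1] := pP o1;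
have [E2 | E2 | E2] := pP o2; rewrite E0 E1 E2 in n01 n12 n02 * => //;
  split; try ring;
  solve [by exists false; rewrite expr0; ring | by exists true; rewrite expr1; ring].
Qed.

End Triples.

Section TripleMorphism.

Variables (R S : comNzRingType) (phi : {rmorphism R -> S}) (f : 'I_3 -> R).

Lemma tri_P_map : phi (tri_P f) = tri_P (phi \o f).
Proof.
by rewrite /tri_P /tri_e1 /tri_e2 /= !(rmorph_nat, rmorphB, rmorphXn, rmorphD, rmorphM).
Qed.

Lemma tri_D_map : phi (tri_D f) = tri_D (phi \o f).
Proof. by rewrite /tri_D !(rmorphB, rmorphM). Qed.

Lemma tri_e1_map : phi (tri_e1 f) = tri_e1 (phi \o f).
Proof. by rewrite /tri_e1 !rmorphD. Qed.

Lemma tri_Q_map : phi (tri_Q f) = tri_Q (phi \o f).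
Proof.
rewrite /tri_Q /tri_e1 /tri_e2 /tri_e3.
by rewrite !(rmorph_nat, rmorphB, rmorphXn, rmorphD, rmorphM).
Qed.

End TripleMorphism.

Section Blocks.

Variables (K L : fieldType) (cst : {rmorphism K -> L}) (gT : finGroupType).
Variable act : gT -> {rmorphism L -> L}.
Hypothesis act1 : forall x, act 1%g x = x.
Hypothesis actM : forall h g x, act h (act g x) = act (h * g)%g x.
Hypothesis act_cst : forall h a, act h (cst a) = cst a.
Hypotheses (K2 : 2%:R != 0 :> K) (K3 : 3%:R != 0 :> K).

Local Notation adj := (adjoin cst).
Local Notation mem_of s := (fun x => x \in s).
Local Notation fixed x := (forall h, act h x = x).

Variables (y : 'I_6 -> L) (rho : gT -> 'S_6).
Hypothesis y_indep : forall p : {mpoly K[6]}, mmap cst y p = 0 -> p = 0.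
Hypothesis act_y : forall h i, act h (y i) = y (rho h i).
Hypothesis rho_blk : forall g, exists (s : bool) (p : bool -> 'I_3 -> 'I_3),
  (forall i, injective (p i)) /\ forall i j, rho g (blk i j) = blk (i (+) s) (p i j).
Hypothesis rho_swap : exists g j j', rho g (blk false j) = blk true j'.
Hypothesis rho_cycle : forall i, exists h,
  [/\ rho h (blk i o0) = blk i o1, rho h (blk i o1) = blk i o2,
      rho h (blk i o2) = blk i o0 & forall j, rho h (blk (~~ i) j) = blk (~~ i) j].

Let x i (j : 'I_3) := y (blk i j).
Let U i := tri_e1 (x i).
Let P i := tri_P (x i).
Let A i := tri_Q (x i) / P i.
Let B i := tri_D (x i) / P i.

Lemma meval_neq0 (v : 'I_6 -> K) p : p.@[v] != 0 -> mmap cst y p != 0.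
Proof. by apply: contra_neq => /y_indep ->; rewrite meval0. Qed.

Let X i (j : 'I_3) : {mpoly K[6]} := 'X_(blk i j).

Lemma x_inj i i' j j' : x i j = x i' j' -> i = i' /\ j = j'.
Proof.
move=> xx; apply: blk_inj; apply/eqP/negPn/negP => neq_b.
have : mmap cst y (X i j - X i' j') != 0.
  apply: (@meval_neq0 (fun k => (k == blk i j)%:R)).
  by rewrite mevalB !mevalXU eqxx [blk i' j' == _]eq_sym (negPf neq_b) subr0 oner_neq0.
by rewrite rmorphB /= !mmapX !mmap1U subr_eq0 -[y _]/(x i j) xx eqxx.
Qed.

Lemma mmap_tri_P i : mmap cst y (tri_P (X i)) = P i.
Proof. by rewrite tri_P_map /tri_P /tri_e1 /tri_e2 /= !mmapX !mmap1U. Qed.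

Lemma mmap_tri_D i : mmap cst y (tri_D (X i)) = tri_D (x i).
Proof. by rewrite tri_D_map /tri_D /= !mmapX !mmap1U. Qed.

Lemma meval_tri_P v i : (tri_P (X i)).@[v] = tri_P (fun j => v (blk i j)).
Proof. by rewrite tri_P_map /tri_P /tri_e1 /tri_e2 /= !mevalXU. Qed.

Lemma meval_tri_D v i : (tri_D (X i)).@[v] = tri_D (fun j => v (blk i j)).
Proof. by rewrite tri_D_map /tri_D /= !mevalXU. Qed.

Lemma P_neq0 i : P i != 0.
Proof.
rewrite -mmap_tri_P; apply: (@meval_neq0 (fun k => (k == blk i o2)%:R)).
rewrite meval_tri_P /tri_P /tri_e1 /tri_e2 eqxx.
have -> : (blk i o0 == blk i o2) = false by case: i.
have -> : (blk i o1 == blk i o2) = false by case: i.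
by rewrite !(mulr0, mul0r, add0r, expr1n, subr0) oner_neq0.
Qed.

Lemma D_neq0 i : tri_D (x i) != 0.
Proof.
by rewrite !mulf_neq0 // subr_eq0; apply/eqP => /x_inj[_].
Qed.

(** The numerator is a polynomial in the y_i; it takes the value 4 when the first
    block is given the values 0, 1, -1 and the second block the values 0, 0, 1. *)
Lemma B_squares_neq0 (e : bool) : B false ^+ 2 + (-1) ^+ e * B true ^+ 2 != 0.
Proof.
have P2 i : P i ^+ 2 != 0 by rewrite expf_neq0 ?P_neq0.
have -> : B false ^+ 2 + (-1) ^+ e * B true ^+ 2 =
    (tri_D (x false) ^+ 2 * P true ^+ 2 + (-1) ^+ e * (tri_D (x true) ^+ 2 * P false ^+ 2))
      / (P false ^+ 2 * P true ^+ 2).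
  by rewrite /B; have := P_neq0 false; have := P_neq0 true; move=> *; field; apply/andP.
rewrite mulf_neq0 ?invr_neq0 ?mulf_neq0 ?P_neq0 //.
pose v (k : 'I_6) : K :=
  (k == blk false o1)%:R - (k == blk false o2)%:R + (k == blk true o2)%:R.
pose num (F : comNzRingType) (d0 p0 d1 p1 : F) :=
  d0 ^+ 2 * p1 ^+ 2 + (-1) ^+ e * (d1 ^+ 2 * p0 ^+ 2).
have num_map (F S : comNzRingType) (phi : {rmorphism F -> S}) d0 p0 d1 p1 :
    phi (num F d0 p0 d1 p1) = num S (phi d0) (phi p0) (phi d1) (phi p1).
  by rewrite /num !(rmorphN1, rmorphD, rmorphM, rmorphXn).
have := @meval_neq0 v
  (num _ (tri_D (X false)) (tri_P (X false)) (tri_D (X true)) (tri_P (X true))).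
rewrite [mmap _ _ _]num_map /= !mmap_tri_P !mmap_tri_D; apply.
rewrite [_.@[v]]num_map /= !meval_tri_P !meval_tri_D.
have -> : tri_D (fun j => v (blk true j)) = 0.
  by rewrite /tri_D /v /= !(subr0, addr0, add0r, subrr, mul0r).
have -> : tri_P (fun j => v (blk true j)) = 1.
  by rewrite /tri_P /tri_e1 /tri_e2 /v /= !(subr0, addr0, add0r, mulr0, mul0r, expr1n).
have -> : tri_D (fun j => v (blk false j)) = 2%:R by rewrite /tri_D /v /=; ring.
by rewrite /num expr1n mulr1 expr0n mul0r mulr0 addr0 expf_neq0.
Qed.

Lemma L_nat_neq0 k : k%:R != 0 :> K -> k%:R != 0 :> L.
Proof. by rewrite -(rmorph_nat cst) fmorph_eq0. Qed.

Lemma tri_signed g s (p : bool -> 'I_3 -> 'I_3) :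
    (forall i, injective (p i)) ->
    (forall i j, rho g (blk i j) = blk (i (+) s) (p i j)) ->
  exists e, signed_type act U A B g s e.
Proof.
move=> p_inj gP.
have gx i j : act g (x i j) = (x (i (+) s) \o p i) j by rewrite act_y gP.
have gU i : act g (U i) = tri_e1 (x (i (+) s) \o p i).
  by rewrite /U tri_e1_map /tri_e1 /= !gx.
have gPi i : act g (P i) = tri_P (x (i (+) s) \o p i).
  by rewrite /P tri_P_map /tri_P /tri_e1 /tri_e2 /= !gx.
have gQ i : act g (tri_Q (x i)) = tri_Q (x (i (+) s) \o p i).
  by rewrite tri_Q_map /tri_Q /tri_e1 /tri_e2 /tri_e3 /= !gx.
have gD i : act g (tri_D (x i)) = tri_D (x (i (+) s) \o p i).
  by rewrite tri_D_map /tri_D /= !gx.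
have /boolp.choice[e De] i : exists e : bool,
    tri_D (x (i (+) s) \o p i) = (-1) ^+ e * tri_D (x (i (+) s)).
  by have [_ _ _] := tri_perm (x (i (+) s)) (p_inj i).
exists e => i; have [E1 EP EQ _] := tri_perm (x (i (+) s)) (p_inj i).
rewrite gU /A /B !fmorph_div gPi gQ gD E1 EP EQ De; split=> //.
exact/esym/mulrA.
Qed.

(** The tower adjoins one point of each block to the field of the block
    invariants, through the two 3-cycles; [signed_descent] treats the rest. *)
Lemma block_descent (b : seq L) :
    (forall z, z \in b -> fixed z) ->
    (forall z, adj (mem_of ([seq y i | i <- enum 'I_6] ++ b)) z) ->
  exists c : seq L, [/\ size c = 6, forall z, z \in c -> fixed z
    & forall z, fixed z -> adj (mem_of (c ++ b)) z].
Proof.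
move=> b_fix gen_b; have L2 := L_nat_neq0 K2; have L3 := L_nat_neq0 K3.
have B_neq0 i : B i != 0 by rewrite mulf_neq0 ?invr_neq0 ?P_neq0 ?D_neq0.
have Bp := B_squares_neq0 false; have Bq := B_squares_neq0 true.
rewrite expr0 mul1r in Bp; rewrite expr1 mulN1r in Bq.
have swapped : exists h e, signed_type act U A B h true e.
  have [g [j [j' gj]]] := rho_swap; have [s [p [p_inj gP]]] := rho_blk g.
  have [e gS] := tri_signed p_inj gP; exists g, e.
  by move: gj; rewrite gP => /blk_inj[/= st _]; rewrite st in gS.
have signed g : exists s e, signed_type act U A B g s e.
  by have [s [p [p_inj gP]]] := rho_blk g; exists s; apply: tri_signed gP.
have [c [szc c_fix gen_c]] :=
  signed_descent act1 actM act_cst L2 B_neq0 Bp Bq signed swapped b_fix.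
exists c; split=> // z z_fix; apply: gen_c => //.
set t := [:: _; _; _; _; _; _] ++ b.
have t_fix i h : [/\ rho h (blk i o0) = blk i o1, rho h (blk i o1) = blk i o2,
      rho h (blk i o2) = blk i o0 & forall j, rho h (blk (~~ i) j) = blk (~~ i) j] ->
    [/\ forall z, z \in t -> act h z = z, act h (x i o0) = x i o1,
      act h (x i o1) = x i o2, act h (x i o2) = x i o0
      & forall j, act h (x (~~ i) j) = x (~~ i) j].
  move=> [h0 h1 h2 h_id].
  have hx0 : act h (x i o0) = x i o1 by rewrite act_y h0.
  have hx1 : act h (x i o1) = x i o2 by rewrite act_y h1.
  have hx2 : act h (x i o2) = x i o0 by rewrite act_y h2.
  have hxn j : act h (x (~~ i) j) = x (~~ i) j by rewrite act_y h_id.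
  split=> // w tw.
  have hU k : act h (U k) = U k.
    rewrite /U tri_e1_map /tri_e1 /=; have [-> | ->] : k = i \/ k = ~~ i.
    - by case: (k); case: (i); [left | right | right | left].
    - by rewrite hx0 hx1 hx2; ring.
    by rewrite !hxn.
  have hP k : act h (P k) = P k.
    rewrite /P tri_P_map /tri_P /tri_e1 /tri_e2 /=; have [-> | ->] : k = i \/ k = ~~ i.
    - by case: (k); case: (i); [left | right | right | left].
    - by rewrite hx0 hx1 hx2; ring.
    by rewrite !hxn.
  have hA k : act h (A k) = A k.
    rewrite /A fmorph_div hP; congr (_ / _).
    rewrite tri_Q_map /tri_Q /tri_e1 /tri_e2 /tri_e3 /=; have [-> | ->] : k = i \/ k = ~~ i.
    - by case: (k); case: (i); [left | right | right | left].
    - by rewrite hx0 hx1 hx2; ring.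
    by rewrite !hxn.
  have hB k : act h (B k) = B k.
    rewrite /B fmorph_div hP; congr (_ / _).
    rewrite tri_D_map /tri_D /=; have [-> | ->] : k = i \/ k = ~~ i.
    - by case: (k); case: (i); [left | right | right | left].
    - by rewrite hx0 hx1 hx2; ring.
    by rewrite !hxn.
  move: tw; rewrite mem_cat => /orP[ | /b_fix //]; rewrite !inE.
  by do 5?[case/orP=> [/eqP-> | ]]; try move/eqP->; rewrite ?hU ?hA ?hB.
have step i (r : seq L) : (forall u, u \in r -> exists j, u = x (~~ i) j) ->
    adj (mem_of [:: x i o0, x i o1, x i o2 & r ++ t]) z -> adj (mem_of (r ++ t)) z.
  move=> rP; have [h hP] := rho_cycle i.
  have [ht hx0 hx1 hx2 hxn] := t_fix i h hP.
  have neq j j' : j != j' -> x i j != x i j' by apply: contra_neq => /x_inj[].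
  apply: (cubic_step (act := act) act1 actM act_cst (h := h) L2 L3) => //;
    rewrite ?neq ?P_neq0 //; try by rewrite !(mem_cat, inE) eqxx ?orbT.
  - by case: i {hP hx0 hx1 hx2 hxn neq rP}; rewrite !(mem_cat, inE) eqxx ?orbT.
  - by case: i {hP hx0 hx1 hx2 hxn neq rP}; rewrite !(mem_cat, inE) eqxx ?orbT.
  - by case: i {hP hx0 hx1 hx2 hxn neq rP}; rewrite !(mem_cat, inE) eqxx ?orbT.
  move=> u; rewrite mem_cat => /orP[/rP[j ->] // | /ht //].
apply: (step false [::]) => //.
apply: (step true [:: x false o0; x false o1; x false o2]).
  by move=> u; rewrite !inE => /or3P[] /eqP->; eexists.
apply: adjoin_mono (gen_b z) => u; rewrite mem_cat => /orP[ | ub]; last first.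
  by rewrite !(mem_cat, inE) ub !orbT.
move=> /mapP[k _ ->]; have [i [j ->]] := blkP k; rewrite -[y _]/(x i j).
have [-> | -> | ->] : [\/ j = o0, j = o1 | j = o2].
- by case: j => [[|[|[|j]]]] Hj //;
    [apply: Or31 | apply: Or32 | apply: Or33]; apply: val_inj.
- by case: i; rewrite !(mem_cat, inE) eqxx ?orbT.
- by case: i; rewrite !(mem_cat, inE) eqxx ?orbT.
- by case: i; rewrite !(mem_cat, inE) eqxx ?orbT.
Qed.

End Blocks.

(** * Groups generated by 3-cycles *)

Section ThreeCycles.

Variable T : finType.
Implicit Types (x y z : T) (s u : {perm T}) (G : {group {perm T}}).

Definition cyc3 x y z : {perm T} := (tperm x y * tperm x z)%g.

Lemma cyc3J x y z u : (cyc3 x y z ^ u)%g = cyc3 (u x) (u y) (u z).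
Proof. by rewrite conjMg !tpermJ. Qed.

Lemma cyc3E x y z k : x != y -> x != z -> y != z ->
  cyc3 x y z k = if k == x then y else if k == y then z else if k == z then x else k.
Proof.
move=> xy xz yz; rewrite permM.
have [-> | kx] := eqVneq k x; first by rewrite tpermL tpermD // eq_sym.
have [-> | ky] := eqVneq k y; first by rewrite tpermR tpermL.
rewrite (tpermD (z := k)) 1?eq_sym //; have [-> | kz] := eqVneq k z.
  by rewrite tpermR.
by rewrite tpermD // eq_sym.
Qed.

(** An even permutation is a product of pairs of transpositions, and
    (x y)(z t) = (x y)(x z) (z x)(z t) is a product of two 3-cycles. *)
Lemma Alt_sub_cyc3 G :
    (forall x y z, x != y -> x != z -> y != z -> cyc3 x y z \in G) ->
  ('Alt_T)%g \subset G.
Proof.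
move=> G3; have G3' x y z : x != y -> x != z -> cyc3 x y z \in G.
  move=> xy xz; have [<- | yz] := eqVneq y z; last exact: G3.
  by rewrite /cyc3 tperm2 group1.
have G4 x y z t : x != y -> z != t -> (tperm x y * tperm z t)%g \in G.
  move=> xy zt; have [xz | xz] := eqVneq x z; first by rewrite -xz in zt *; apply: G3'.
  have -> : (tperm x y * tperm z t)%g = (cyc3 x y z * cyc3 z x t)%g.
    by rewrite /cyc3 (tpermC z x) -!mulgA (mulgA (tperm x z)) tperm2 mul1g.
  by rewrite groupM ?G3' // eq_sym.
apply/subsetP=> s; rewrite Alt_even; have [ts -> dts] := prod_tpermP s.
elim: {ts}(size ts).+1 {-2}ts (ltnSn (size ts)) dts => // n IHn [|t1 [|t2 ts]] /=.
- by rewrite big_nil group1.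
- by move=> _ /andP[dt1 _]; rewrite big_seq1 odd_tperm dt1.
move=> szts /and3P[dt1 dt2 dts]; rewrite !big_cons mulgA odd_permM => even.
rewrite groupM ?G4 //; apply: IHn => //; first exact: ltnW.
by move: even; rewrite odd_permM !odd_tperm dt1 dt2.
Qed.

Lemma Alt_sub_cases G : ('Alt_T)%g \subset G ->
  G = ('Alt_T)%g :> {set _} \/ G = ('Sym_T)%g :> {set _}.
Proof.
move=> sAG; have [sGA | /subsetPn[g Gg]] := boolP (G \subset ('Alt_T)%g).
  by left; apply/eqP; rewrite eqEsubset sGA.
rewrite Alt_even negbK => odd_g; right; apply/eqP; rewrite eqEsubset subsetT.
apply/subsetP=> s _; have [odd_s | even_s] := boolP (odd_perm s).
  rewrite -(groupMr _ Gg); apply: (subsetP sAG).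
  by rewrite Alt_even odd_permM odd_s odd_g.
by apply: (subsetP sAG); rewrite Alt_even.
Qed.

End ThreeCycles.

Section TripleOrbit.

Local Open Scope nat_scope.
Implicit Types (l : seq nat) (x y z : 'I_6) (u : 'S_6).

Definition ncyc (g : nat * nat * nat) k :=
  let: (a, b, c) := g in
  if k == a then b else if k == b then c else if k == c then a else k.

Definition norm6 l := [seq k <- iota 0 6 | k \in l].

Definition triples6 :=
  [seq t <- allpairs pair (allpairs pair (iota 0 6) (iota 0 6)) (iota 0 6)
     | size (norm6 [:: t.1.1; t.1.2; t.2]) == 3].

Definition set_of_triple (t : nat * nat * nat) := norm6 [:: t.1.1; t.1.2; t.2].

Definition move_set (g : nat * nat * nat) l := norm6 (map (ncyc g) l).

Definition grow (gs : seq (nat * nat * nat)) (s : seq (seq nat)) :=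
  undup (s ++ allpairs move_set gs s).

Definition one_block l := all (fun k => k < 3) l || all (fun k => 3 <= k) l.

(** Six points are numbered from 0 to 5, and a set of three points is represented
    by its increasing sequence. The 3-cycles on the two blocks and any 3-cycle on a
    set that meets both blocks move this set to every set of three points; five
    rounds suffice. *)
Lemma mixed_orbit : all (fun t => one_block (set_of_triple t) ||
  all (mem (iter 5 (grow [:: (0, 1, 2); (3, 4, 5); t]) [:: set_of_triple t]))
    (map set_of_triple triples6)) triples6.
Proof. by vm_compute. Qed.

Lemma mem_norm6 l (j : 'I_6) : (val j \in norm6 l) = (val j \in l).
Proof. by rewrite mem_filter mem_iota /= ltn_ord andbT. Qed.

Lemma mem_set_of_triple x y z (j : 'I_6) :
  (val j \in set_of_triple (val x, val y, val z)) = (j \in [:: x; y; z]).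
Proof. by rewrite mem_norm6 -(mem_map val_inj). Qed.

Lemma triple_in_triples6 x y z : x != y -> x != z -> y != z ->
  (val x, val y, val z) \in triples6.
Proof.
move=> xy xz yz; rewrite mem_filter; apply/andP; split; last first.
  by apply: allpairs_f; [apply: allpairs_f |]; rewrite mem_iota add0n ltn_ord.
have /perm_size -> : perm_eq (norm6 [:: val x; val y; val z]) [:: val x; val y; val z].
  apply: uniq_perm; first by rewrite filter_uniq // iota_uniq.
    by rewrite /= !inE negb_or -!val_eqE in xy xz yz *; rewrite xy xz yz.
  move=> k; rewrite mem_filter andb_idr // mem_iota add0n.
  by rewrite !inE => /or3P[] /eqP->; rewrite ltn_ord.
by [].
Qed.

Variable G : {group 'S_6}.

(** Both orientations are included, so that a set of points determines the
    property. *)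
Definition cycles_on l := all (fun k => k < 6) l /\
  forall x y z, x != y -> x != z -> y != z ->
    (forall j : 'I_6, (val j \in l) = (j \in [:: x; y; z])) -> cyc3 x y z \in G.

Definition realized (g : nat * nat * nat) := exists2 u, u \in G &
  forall j : 'I_6, val (u j) = ncyc g (val j).

Lemma norm6_lt6 l : all (fun k => k < 6) (norm6 l).
Proof. by apply/allP=> k; rewrite mem_filter mem_iota => /andP[]. Qed.

Lemma cycles_on_move g l : realized g -> cycles_on l -> cycles_on (move_set g l).
Proof.
move=> [u Gu Du] [l6 Gl]; split; first exact: norm6_lt6.
move=> x y z xy xz yz Dl; rewrite -[x](permKV u) -[y](permKV u) -[z](permKV u) -cyc3J.
rewrite groupJ // Gl ?(inj_eq perm_inj) // => j.
have -> : (j \in [:: (u^-1)%g x; (u^-1)%g y; (u^-1)%g z]) = (u j \in [:: x; y; z]).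
  have uE w : (j == (u^-1)%g w) = (u j == w) by apply/eqP/eqP=> [->|<-]; rewrite ?permKV ?permK.
  by rewrite !inE !uE.
rewrite -Dl mem_norm6 Du; apply/idP/idP => [jl | /mapP[k kl jk]]; first exact: map_f.
have lt6 := allP l6 _ kl.
have : u j = u (Ordinal lt6) by apply: val_inj; rewrite !Du.
by move/perm_inj->.
Qed.

Lemma cyc3_realized x y z : x != y -> x != z -> y != z -> cyc3 x y z \in G ->
  realized (val x, val y, val z).
Proof.
move=> xy xz yz Gxyz; exists (cyc3 x y z) => // j.
by rewrite cyc3E //= !val_eqE; case: eqP => // _; case: eqP => // _; case: eqP.
Qed.

Lemma cycles_on_triple a b c : a != b -> a != c -> b != c -> cyc3 a b c \in G ->
  cycles_on (set_of_triple (val a, val b, val c)).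
Proof.
move=> ab ac bc Gabc; split; first exact: norm6_lt6.
have rot p q r : p != q -> p != r -> q != r -> cyc3 p q r \in G -> cyc3 q r p \in G.
  move=> pq pr qr Gpqr; have := cyc3J p q r (cyc3 p q r).
  rewrite !cyc3E // !eqxx [q == p]eq_sym (negPf pq) [r == p]eq_sym (negPf pr).
  by rewrite [r == q]eq_sym (negPf qr) => <-; rewrite groupJ.
have inv p q r : cyc3 p q r \in G -> cyc3 p r q \in G.
  by rewrite -groupV /cyc3 invMg !tpermV.
have Gbca := rot _ _ _ ab ac bc Gabc.
have Gcab : cyc3 c a b \in G by apply: rot Gbca; rewrite // eq_sym.
move=> x y z xy xz yz Dl.
have sub w : w \in [:: x; y; z] -> w \in [:: a; b; c].
  by rewrite -Dl mem_set_of_triple.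
have := sub x; rewrite !inE eqxx /= => /(_ isT).
have := sub y; rewrite !inE eqxx orbT /= => /(_ isT).
have := sub z; rewrite !inE eqxx !orbT /= => /(_ isT).
move=> /or3P[] /eqP Ez /or3P[] /eqP Ey /or3P[] /eqP Ex; rewrite Ex Ey Ez ?eqxx // in xy xz yz *;
  by [| apply: inv].
Qed.

Lemma Alt_sub_mixed (a b c : 'I_6) :
    cyc3 (inord 0) (inord 1) (inord 2) \in G -> cyc3 (inord 3) (inord 4) (inord 5) \in G ->
    a != b -> a != c -> b != c -> cyc3 a b c \in G ->
    ~~ one_block (set_of_triple (val a, val b, val c)) ->
  ('Alt_('I_6))%g \subset G.
Proof.
move=> G012 G345 ab ac bc Gabc mixed; apply: Alt_sub_cyc3 => x y z xy xz yz.
set t := (val a, val b, val c) in mixed.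
have : set_of_triple (val x, val y, val z) \in
    iter 5 (grow [:: (0, 1, 2); (3, 4, 5); t]) [:: set_of_triple t].
  have /allP/(_ t) := mixed_orbit; rewrite (negPf mixed) => /(_ _)/allP.
  by apply; rewrite ?map_f // triple_in_triples6.
have ord_neq i j : i < 6 -> j < 6 -> i != j -> inord i != inord j :> 'I_6.
  by move=> i6 j6; rewrite -val_eqE /= !inordK.
have gens g : g \in [:: (0, 1, 2); (3, 4, 5); t] -> realized g.
  rewrite !inE => /or3P[] /eqP->; last exact: cyc3_realized.
    have := @cyc3_realized (inord 0) (inord 1) (inord 2) _ _ _ G012.
    by rewrite /= !inordK // !ord_neq //; apply.
  have := @cyc3_realized (inord 3) (inord 4) (inord 5) _ _ _ G345.
  by rewrite /= !inordK // !ord_neq //; apply.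
suff orbit_ok n l : l \in iter n (grow [:: (0, 1, 2); (3, 4, 5); t]) [:: set_of_triple t] ->
    cycles_on l.
  move/orbit_ok=> [_]; apply=> // j; exact: mem_set_of_triple.
elim: n l => [|n IHn] l; first by rewrite inE => /eqP->; apply: cycles_on_triple.
rewrite mem_undup mem_cat => /orP[/IHn // | /allpairsP[[g l'] /= [gs /IHn l'ok ->]]].
by apply: cycles_on_move l'ok; apply: gens.
Qed.

End TripleOrbit.

(** * Transitive groups containing C_3 x C_3 *)

Definition blk_cycle i : 'S_6 := cyc3 (blk i o0) (blk i o1) (blk i o2).

Lemma blk_neq i j j' : j != j' -> blk i j != blk i j'.
Proof. by apply: contra_neq => /blk_inj[]. Qed.

Lemma blk_cycleE i :
  [/\ blk_cycle i (blk i o0) = blk i o1, blk_cycle i (blk i o1) = blk i o2,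
      blk_cycle i (blk i o2) = blk i o0
    & forall j, blk_cycle i (blk (~~ i) j) = blk (~~ i) j].
Proof.
have n01 := @blk_neq i o0 o1 isT; have n02 := @blk_neq i o0 o2 isT.
have n12 := @blk_neq i o1 o2 isT.
have b j j' : (blk (~~ i) j == blk i j') = false.
  by apply/eqP => /blk_inj[/esym]; case: (i).
rewrite /blk_cycle; split; rewrite ?cyc3E ?eqxx //.
- by rewrite eq_sym (negPf n01).
- by rewrite eq_sym (negPf n02) eq_sym (negPf n12).
by move=> j; rewrite cyc3E // !b.
Qed.

Lemma ord3P (j : 'I_3) : [\/ j = o0, j = o1 | j = o2].
Proof.
by case: j => [[|[|[|j]]]] Hj //;
  [apply: Or31 | apply: Or32 | apply: Or33]; apply: val_inj.
Qed.

Lemma blk_cycle_order i : #[blk_cycle i]%g = 3%N.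
Proof.
have := blk_cycleE i; move: (blk_cycle i) => a [c0 c1 c2 cn].
apply: nt_prime_order => //; last first.
  apply/eqP=> c1'; move: c0; rewrite c1' perm1 => /eqP.
  by apply/negP; apply: blk_neq.
apply/permP=> k; rewrite perm1; have [i' [j ->]] := blkP k.
rewrite !expgS expg0 mulg1 !permM.
have [-> | ->] : i' = i \/ i' = ~~ i by case: (i'); case: (i); [left | right | right | left].
  by have [-> | -> | ->] := ord3P j; rewrite ?(c0, c1, c2) ?(c0, c1, c2) ?(c0, c1, c2).
by rewrite !cn.
Qed.

Lemma blk_cycle_comm : commute (blk_cycle false) (blk_cycle true).
Proof.
have := blk_cycleE false; have := blk_cycleE true.
move: (blk_cycle false) (blk_cycle true) => a b [t0 t1 t2 tn] [f0 f1 f2 fn].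
apply/permP=> k; rewrite !permM; have [i [j ->]] := blkP k.
by case: i; have [-> | -> | ->] := ord3P j;
  rewrite ?(fn, tn, f0, f1, f2, t0, t1, t2) ?(fn, tn).
Qed.

(** The two 3-cycles generate a group of order 9, a Sylow 3-subgroup of the
    symmetric group of degree 6. *)
Lemma C3xC3_conj (H : {group 'S_6}) : #|H| = 9%N ->
  exists x : 'S_6, forall i, (blk_cycle i ^ x \in H)%g.
Proof.
move=> cardH; pose a i := blk_cycle i; have com : commute (a false) (a true) := blk_cycle_comm.
pose P := (<[a false]> <*> <[a true]>)%G.
have TI : (<[a false]> :&: <[a true]> = 1)%g.
  apply: prime_TIg; first by rewrite -orderE blk_cycle_order.
  rewrite cycle_subG; apply/negP => /cycleP[m Dm].
  have [f0 _ _ _] := blk_cycleE false; have [_ _ _ tn] := blk_cycleE true.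
  have : (a true ^+ m)%g (blk false o0) = blk false o0.
    by elim: m {Dm} => [|m IHm]; rewrite ?perm1 // expgS permM (tn o0).
  by rewrite -Dm f0 => /eqP; apply/negP/blk_neq.
have cardP : #|P| = 9%N.
  rewrite /= cent_joinEr; last exact/cents_cycle/esym.
  by rewrite TI_cardMg // -!orderE !blk_cycle_order.
have sylP : (3.-Sylow('Sym_('I_6)) P)%g.
  rewrite pHallE subsetT cardP card_Sym card_ord.
  by apply/eqP; rewrite p_part; vm_compute.
have pH : (3.-group H)%g by rewrite /pgroup cardH.
have [x _ sHP] := Sylow_Jsub sylP (subsetT H) pH.
exists (x^-1)%g => i; rewrite -mem_conjg.
have -> : (H :^ x = P)%g by apply/eqP; rewrite eqEcard sHP cardJg cardH cardP.
by case: i; rewrite mem_gen // inE cycle_id ?orbT.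
Qed.

(** If g mixed the blocks, the conjugate by g of a block 3-cycle would be a 3-cycle
    meeting both blocks. Two blocks cannot have the same image, as g is onto. *)
Lemma preserves_blocks (G : {group 'S_6}) :
    (forall i, blk_cycle i \in G) -> ~~ (('Alt_('I_6))%g \subset G) ->
  forall g, g \in G -> exists (s : bool) (p : bool -> 'I_3 -> 'I_3),
    (forall i, injective (p i)) /\ forall i j, g (blk i j) = blk (i (+) s) (p i j).
Proof.
move=> Gc notAlt g Gg.
have img i : exists s, forall j, exists j', g (blk i j) = blk s j'.
  have : one_block (set_of_triple (val (g (blk i o0)), val (g (blk i o1)), val (g (blk i o2)))).
    apply: contraR notAlt; apply: Alt_sub_mixed; rewrite ?(inj_eq perm_inj) ?blk_neq //.
    - have := Gc false; rewrite /blk_cycle; congr (cyc3 _ _ _ \in G);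
        by apply: val_inj; rewrite /= inordK.
    - have := Gc true; rewrite /blk_cycle; congr (cyc3 _ _ _ \in G);
        by apply: val_inj; rewrite /= inordK.
    by rewrite -cyc3J groupJ // Gc.
  have in_set j : val (g (blk i j)) \in
      set_of_triple (val (g (blk i o0)), val (g (blk i o1)), val (g (blk i o2))).
    rewrite mem_set_of_triple !inE !(inj_eq perm_inj).
    by case: j => [[|[|[|j]]]] Hj //; rewrite -!val_eqE; case: i.
  case/orP=> /allP all_s; [exists false | exists true] => j.
    have := all_s _ (in_set j); have [i' [j' ->]] := blkP (g (blk i j)).
    by case: i' => // _; exists j'.
  have := all_s _ (in_set j); have [i' [j' ->]] := blkP (g (blk i j)).
  by case: i' => [_ | /=]; [exists j' | rewrite leqNgt ltn_ord].
have [s img0] := img false; have [s' img1] := img true.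
have s's : s' = ~~ s.
  apply/eqP/negPn/negP => neq; have Es : s' = s by case: (s) (s') neq => [] [].
  have [i [j Dk]] := blkP ((g^-1)%g (blk (~~ s) o0)).
  have : exists j', g (blk i j) = blk s j' by case: (i) => //; rewrite -Es.
  by rewrite -Dk permKV => -[j' /blk_inj[]]; case: (s).
have img2 i j : exists j', g (blk i j) = blk (i (+) s) j'.
  by case: i; [rewrite addTb -s's; apply: img1 | rewrite addFb; apply: img0].
pose p i := projT1 (boolp.choice (img2 i)).
have Dp i : forall j, g (blk i j) = blk (i (+) s) (p i j) := projT2 (boolp.choice (img2 i)).
exists s, p; split=> // i j j' pjj'.
have : g (blk i j) = g (blk i j') by rewrite !Dp pjj'.
by move/perm_inj/blk_inj=> [].
Qed.

Section Assembly.

Variables (G : {group 'S_6}) (x : 'S_6) (k0 : 'I_6).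

(** The labelling x of the points is built into the orbit map and the action. The
    inverses are due to permutations composing from left to right. *)
Definition orbit_point (g : [subg G]) : 'I_6 := (x^-1)%g ((sgval g)^-1%g k0).
Definition point_perm (h : [subg G]) : 'S_6 := (x * (sgval h)^-1 * x^-1)%g.

Lemma orbit_pointM h g : orbit_point (h * g)%g = point_perm h (orbit_point g).
Proof. by rewrite /orbit_point /point_perm morphM ?inE // invMg !permM permKV. Qed.

Lemma point_perm_inj : injective point_perm.
Proof. by move=> g h /mulIg/mulgI/invg_inj/val_inj. Qed.

Lemma orbit_point_surj : [transitive G, on [set: 'I_6] | 'P]%g ->
  exists rep, cancel rep orbit_point.
Proof.
move=> trG; have repP k : exists g, orbit_point g = k.
  have [a Ga Dk] := atransP2 trG (in_setT k0) (in_setT (x k)).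
  exists (subg G a^-1%g); rewrite /orbit_point subgK ?groupV // invgK.
  by rewrite -[a k0]/('P%act k0 a) -Dk permK.
have [rep Drep] := boolp.choice repP.
by exists rep.
Qed.

End Assembly.

Lemma pchar_neq0 (K : fieldType) p : prime p -> p \notin [pchar K] -> p%:R != 0 :> K.
Proof. by move=> p_pr; rewrite inE p_pr. Qed.

Lemma card_C3xC3 (H : {group 'S_6}) : (H \isog setX (Zp 3) (Zp 3))%g -> #|H| = 9%N.
Proof. by move/card_isog->; rewrite cardsX card_Zp. Qed.

Lemma noether_of_blocks (K : fieldType) (gT : finGroupType)
    (pt : gT -> 'I_6) (rho : gT -> 'S_6) (rep : 'I_6 -> gT) :
    2%:R != 0 :> K -> 3%:R != 0 :> K ->
    cancel rep pt -> (forall h g, pt (h * g)%g = rho h (pt g)) -> injective rho ->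
    (forall g, exists (s : bool) (p : bool -> 'I_3 -> 'I_3),
      (forall i, injective (p i)) /\ forall i j, rho g (blk i j) = blk (i (+) s) (p i j)) ->
    (forall i, exists h, rho h = blk_cycle i) ->
  noether_problem K gT.
Proof.
move=> K2 K3 repK ptM rho_inj rho_blk rho_cyc.
have [b [szb b_inv gen_b]] := no_name K repK ptM rho_inj.
have rho_swap : exists g j j', rho g (blk false j) = blk true j'.
  exists (rep (blk true o0) * (rep (blk false o0))^-1)%g, o0, o0.
  have := ptM (rep (blk true o0) * (rep (blk false o0))^-1)%g (rep (blk false o0)).
  by rewrite mulgKV !repK.
have rho_cycle i : exists h,
  [/\ rho h (blk i o0) = blk i o1, rho h (blk i o1) = blk i o2,
      rho h (blk i o2) = blk i o0 & forall j, rho h (blk (~~ i) j) = blk (~~ i) j].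
  by have [h Dh] := rho_cyc i; exists h; rewrite Dh; apply: blk_cycleE.
have [|c [szc c_inv gen_c]] := @block_descent K _ (@frac_const K gT) gT
  (fun h => frac_act h) (@frac_act1 K gT) (@frac_actM K gT) (@frac_act_const K gT) K2 K3
  (orbit_var K pt) rho (mmap_orbit_var_eq0 repK) (frac_act_orbit_var K ptM)
  rho_blk rho_swap rho_cycle b _ gen_b.
  by move=> z /b_inv/noether_fieldP.
apply: (@noether_criterion _ _ (c ++ b)).
- by rewrite size_cat szc addnC szb.
- by move=> z; rewrite mem_cat => /orP[/c_inv z_inv | /b_inv //]; apply/noether_fieldP.
by move=> z /noether_fieldP; apply: gen_c.
Qed.

Theorem corollary1p2 :
  (forall G : {group 'S_6},
     [transitive G, on [set: 'I_6] | 'P]%g ->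
     (exists H : {group 'S_6},
        (H \subset G)%g /\ (H \isog setX (Zp 3) (Zp 3))%g) ->
     G <> ('Alt_('I_6))%g :> {set 'S_6} ->
     G <> ('Sym_('I_6))%g :> {set 'S_6} ->
     forall K : fieldType,
       2%N \notin [pchar K] -> 3%N \notin [pchar K] ->
       noether_problem K [subg G])
  /\
  (forall K : fieldType,
     2%N \notin [pchar K] -> 3%N \notin [pchar K] -> 5%N \notin [pchar K] ->
     noether_problem K [subg 'Sym_('I_6)]).
Proof.
split=> [G trG [H [sHG /card_C3xC3/C3xC3_conj[x Hx]]] notAlt notSym K K2 K3 | K _ _ _].
  have [rep repK] := orbit_point_surj x ord0 trG.
  pose G' := (G :^ x^-1)%G.
  have rhoG' (h : [subg G]) : point_perm x h \in G'.
    rewrite mem_conjgV /point_perm /conjg !mulgA mulVg mul1g mulgKV groupV.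
    exact: subgP.
  have G'cyc i : blk_cycle i \in G' by rewrite mem_conjgV (subsetP sHG) ?Hx.
  have notAlt' : ~~ (('Alt_('I_6))%g \subset G').
    apply/negP=> sAG'; have sAG : ('Alt_('I_6))%g \subset G.
      rewrite -(normP (subsetP (Alt_norm _) (x^-1)%g (in_setT _))) in sAG'.
      by rewrite conjSg in sAG'.
    by have [] := Alt_sub_cases sAG.
  apply: (noether_of_blocks (pchar_neq0 (isT : prime 2) K2)
    (pchar_neq0 (isT : prime 3) K3) repK (@orbit_pointM G x ord0)
    (@point_perm_inj G x)) => [g | i].
    exact: (preserves_blocks G'cyc notAlt' (rhoG' g)).
  exists (subg G (x^-1 * (blk_cycle i)^-1 * x)%g).
  rewrite /point_perm subgK; last first.
    rewrite -mulgA; have := groupVr (Hx i); rewrite -conjVg => /(subsetP sHG).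
    by [].
  by rewrite !invMg !invgK !mulgA mulgV mul1g mulgK.
have trS : [transitive 'Sym_('I_6), on [set: 'I_6] | 'P]%g.
  apply/imsetP; exists ord0; rewrite ?inE //; apply/setP=> k; rewrite inE.
  by apply/esym/imsetP; exists (tperm ord0 k); rewrite ?inE //= /aperm tpermL.
have [rep repK] := orbit_point_surj 1%g ord0 trS.
apply: (noether_symmetric K repK (@orbit_pointM _ 1%g ord0) (@point_perm_inj _ 1%g)) => s.
exists (subg _ (s^-1)%g); rewrite /point_perm subgK ?inE //.
by rewrite invgK invg1 mul1g mulg1.
Qed.
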